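(* Let $R$ be an associative algebra with unity over a field $F$ such that the group of units $U(R)$ contains an $\omega$-subgroup, and let $\nabla(R)$ be the $FC$-subalgebra of $R$. Let $A$ be the set of all elements of $\nabla(R)$ that are algebraic over $F$. Then $A$ is a locally finite $F$-algebra, the Jacobson radical $\mathfrak{J}(A)$ is a central locally nilpotent ideal in $\nabla(R)$, and $A/\mathfrak{J}(A)$ is commutative.
   Context: $U(R)$ denotes the group of units of $R$. For $a\in R$, $C_{U(R)}(a)=\{u\in U(R)\mid ua=au\}$. The $FC$-subring (here an $F$-subalgebra) of $R$ is $\nabla(R)=\{a\in R\mid [U(R):C_{U(R)}(a)]<\infty\}$. An infinite subgroup $H$ of $U(R)$ is called an $\omega$-subgroup if for every $x,y\in R$ with $[x,y]=xy-yx\neq 0$, the left annihilator $\{r\in R\mid r[x,y]=0\}$ contains only finitely many elements of the form $1-h$ with $h\in H$. An algebra over $F$ is locally finite if every finitely generated subalgebra is finite dimensional over $F$. ''Central in $\nabla(R)$'' means contained in the center of $\nabla(R)$. An ideal is locally nilpotent if each of its finitely generated subrings is nilpotent. *)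

(* Defs.v *)
From HB Require Import structures.
From mathcomp Require Import all_boot all_order all_algebra.
From mathcomp Require Import boolp classical_sets functions cardinality.

Set Implicit Arguments.
Unset Strict Implicit.
Unset Printing Implicit Defensive.

Import GRing.Theory.

Local Open Scope classical_set_scope.
Local Open Scope ring_scope.

(* Subrings, ideals, etc. of the ambient ring R are
   represented by their carriers, of type [set R]; the library closure
   predicates, stated for [{pred R}], apply to them through [mem]. *)

Section Rings.
Variable R : nzRingType.
Implicit Types (G H S I X : set R) (a x y : R).

(* [GRing.unit] would require a decidable inverse on R. *)
Definition unit_group : set R := [set u | exists v, v * u = 1 /\ u * v = 1].

Definition is_unit_subgroup H : Prop :=
  [/\ H `<=` unit_group, H 1, (forall u v, H u -> H v -> H (u * v))
    & forall u v, H u -> v * u = 1 -> u * v = 1 -> H v].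

Definition unit_centralizer a : set R := [set u | unit_group u /\ u * a = a * u].

Definition finite_index G H : Prop :=
  finite_set [set [set g * h | h in H] | g in G].

Definition fc_subring : set R :=
  [set a | finite_index unit_group (unit_centralizer a)].

Definition commutator x y : R := x * y - y * x.

Definition left_annihilator x : set R := [set r | r * x = 0].

Definition omega_subgroup H : Prop :=
  [/\ is_unit_subgroup H, infinite_set H
    & forall x y, commutator x y != 0 ->
        finite_set (left_annihilator (commutator x y) `&` [set 1 - h | h in H])].

Definition center_of S : set R :=
  [set z | S z /\ forall x, S x -> z * x = x * z].

Definition is_left_ideal S I : Prop :=
  [/\ I `<=` S, GRing.zmod_closed (mem I)
    & forall x y, S x -> I y -> I (x * y)].

Definition is_ideal S I : Prop :=
  is_left_ideal S I /\ forall x y, I x -> S y -> I (x * y).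

Definition is_maximal_left_ideal S I : Prop :=
  [/\ is_left_ideal S I, I <> S
    & forall L, is_left_ideal S L -> I `<=` L -> L = I \/ L = S].

(* The leading [S `&`] matters only when there is no maximal left ideal. *)
Definition jacobson_radical S : set R :=
  S `&` \bigcap_(I in is_maximal_left_ideal S) I.

(* Not required to contain 1: an ideal is regarded as a ring without unity. *)
Definition is_nonunital_subring S : Prop :=
  GRing.zmod_closed (mem S) /\ GRing.mulr_2closed (mem S).

Definition generated_subring X : set R := smallest is_nonunital_subring X.

Definition is_nilpotent S : Prop :=
  exists2 n : nat, (0 < n)%N &
    forall s : 'I_n -> R, (forall i, S (s i)) -> \prod_(i < n) s i = 0.

Definition is_locally_nilpotent I : Prop :=
  forall X, finite_set X -> X `<=` I -> is_nilpotent (generated_subring X).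

(* The quotient ring S / I as a set of cosets.  When I is an ideal of S,
   [coset_mul I (coset I a) (coset I b) = coset I (a * b)] for a, b in S. *)
Definition coset I a : set R := [set a + j | j in I].

Definition quotient_by S I : set (set R) := [set coset I a | a in S].

Definition coset_mul I (Y Z : set R) : set R :=
  [set p.1 * p.2 + j | p in Y `*` Z & j in I].

Definition is_commutative_quotient S I : Prop :=
  forall Y Z, quotient_by S I Y -> quotient_by S I Z ->
    coset_mul I Y Z = coset_mul I Z Y.

End Rings.

Section Algebras.
Variables (F : fieldType) (R : algType F).
Implicit Types (S X : set R) (a : R).

(* [algebraicOver] is only available when R is a field. *)
Definition is_algebraic a : Prop :=
  exists2 p : {poly F}, p != 0 & horner_alg a p = 0.

Definition is_subalgebra S : Prop := GRing.subalg_closed (mem S).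

Definition generated_subalgebra X : set R := smallest is_subalgebra X.

Definition is_finite_dimensional S : Prop :=
  exists (n : nat) (b : 'I_n -> R),
    S = [set \sum_(i < n) c i *: b i | c in [set: 'I_n -> F]].

Definition is_locally_finite_algebra S : Prop :=
  is_subalgebra S /\
  forall X, finite_set X -> X `<=` S ->
    is_finite_dimensional (generated_subalgebra X).

Definition fc_algebraic : set R := [set a | fc_subring a /\ is_algebraic a].

End Algebras.

Arguments unit_group {R}.
Arguments fc_subring {R}.
Arguments fc_algebraic {F R}.

(* Main.v *)
Require Import Defs.
From HB Require Import structures.
From mathcomp Require Import all_boot all_order all_algebra.
From mathcomp Require Import finfield finmap.
From mathcomp Require Import boolp classical_sets functions cardinality.

(** Write FC for the FC-subring and A for its set of algebraic elements.  The
    engine is a pigeonhole principle: if infinitely many units are given and [y]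
    lies in FC, then infinitely many of them conjugate [y] to the same element
    ([fc_infinite_same_conjugate]).  Applied to the units [1 + x * h], where [x]
    is nilpotent in FC and [h] runs over the (infinite) common centralizer of [x]
    and [y] in the omega-subgroup, it produces infinitely many differences
    [h - k] that annihilate a commutator, so that this commutator vanishes.
    Hence every nilpotent element of FC, and therefore every idempotent of FC,
    is central in FC ([fc_nilpotent_central], [idempotent_commutes]).

    It follows that A is commutative ([fc_algebraic_commute]).  Over an infinite
    field the pigeonhole principle applied to the units [a - c], with [c] a
    scalar, shows that an algebraic [a] commutes with all of FC.  Over a finite
    field an element of A is a torsion unit plus a central element
    ([fc_torsion_decomposition]), because its powers contain an idempotent.  Two
    torsion units of FC have finitely many conjugates, and by Dietzmann's argument
    ([finite_words]) these generate a finite monoid; its span is a finite ring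
    of prime characteristic with central nilpotent elements.  Such a ring is
    commutative ([finite_nilpotent_central_commutative]): below a primitive
    idempotent it is local with nil radical, so Wedderburn's little theorem makes
    its commutators nilpotent, hence central, and a Frobenius argument then
    makes them zero.

    Once A is commutative, monomials in finitely many elements of A span a
    finite-dimensional subalgebra, so A is a locally finite algebra.  Its Jacobson
    radical is the set of nilpotent elements of FC ([jacobson_fc_algebraic]),
    which is central; finitely many central nilpotents generate a nilpotent
    ideal ([ideal_span_nilpotent]), whence local nilpotence. *)

Set Implicit Arguments.
Unset Strict Implicit.
Unset Printing Implicit Defensive.

Import GRing.Theory.

Local Open Scope classical_set_scope.
Local Open Scope ring_scope.

(** * Infinite fibres *)

Lemma infinite_fiber (T U : Type) (D : set T) (f : T -> U) :
    infinite_set D -> finite_set (f @` D) ->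
  exists2 t, D t & infinite_set [set s | D s /\ f s = f t].
Proof.
move=> Dinf ffin; apply: contrapT => nex; apply: Dinf.
apply: (@sub_finite_set _ _ (\bigcup_(u in f @` D) [set s | D s /\ f s = u])).
  by move=> t Dt; exists (f t) => //; exists t.
apply: bigcup_finite => // _ [t Dt <-].
by apply: contrapT => inf; apply: nex; exists t.
Qed.

Lemma infinite_set_neq (T : Type) (D : set T) (t : T) :
  infinite_set D -> exists2 s, D s & s <> t.
Proof.
move=> Dinf; apply: contrapT => nex; apply: Dinf.
apply: (@sub_finite_set _ _ [set t]); last exact: finite_set1.
by move=> s Ds /=; apply: contrapT => st; apply: nex; exists s.
Qed.

Lemma finite_range_repeat (T : Type) (f : nat -> T) :
  finite_set (range f) -> exists i d, f i = f (i + d.+1)%N.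
Proof.
move=> /(infinite_fiber infinite_nat)[i _ /(infinite_set_neq i)[j [_ e] /eqP]].
rewrite neq_ltn => /orP[ltji|ltij].
  by exists j, (i - j).-1; rewrite prednK ?subn_gt0 // subnKC // ltnW.
by exists i, (j - i).-1; rewrite prednK ?subn_gt0 // subnKC // ltnW.
Qed.

(** * Nilpotent elements, subrings and commutators *)

Section Nilpotent.
Variable R : nzRingType.
Implicit Types (S : set R) (x y z : R).

Definition nilpotent x := exists n, x ^+ n = 0.

Definition subring S : Prop :=
  [/\ S 1, forall x y, S x -> S y -> S (x - y)
    & forall x y, S x -> S y -> S (x * y)].

Definition commutes_with S x : Prop := forall y, S y -> x * y = y * x.

Lemma nilpotent0 : nilpotent 0.
Proof. by exists 1%N; rewrite expr1. Qed.

Lemma expr0_le x m n : (m <= n)%N -> x ^+ m = 0 -> x ^+ n = 0.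
Proof. by move=> /subnK<- xm0; rewrite exprD xm0 mulr0. Qed.

Lemma nilpotentM x y : x * y = y * x -> nilpotent x -> nilpotent (x * y).
Proof. by move=> cxy [n xn0]; exists n; rewrite exprMn_comm // xn0 mul0r. Qed.

Lemma nilpotentN x : nilpotent x -> nilpotent (- x).
Proof. by case=> n xn0; exists n; rewrite exprNn xn0 mulr0. Qed.

Lemma nilpotentD x y :
  x * y = y * x -> nilpotent x -> nilpotent y -> nilpotent (x + y).
Proof.
move=> cxy [m xm0] [n yn0]; exists (m + n)%N.
rewrite exprDn_comm // big1 // => i _.
have [le_ni|lt_in] := leqP n i.
  by rewrite (expr0_le le_ni yn0) mulr0 mul0rn.
rewrite (@expr0_le x m) ?mul0r ?mul0rn //.
by rewrite -addnBA ?leq_addr // ltnW.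
Qed.

(** The geometric series inverts [1 - x]. *)
Lemma nilpotent_unit1B x : nilpotent x -> unit_group (1 - x).
Proof.
case=> n xn0; exists (\sum_(i < n) x ^+ i).
have cx : GRing.comm (1 - x) (\sum_(i < n) x ^+ i).
  apply: commr_sum => i _; apply: commrX; apply/commr_sym.
  by apply: commrB; [apply: commr1|].
have h : (1 - x) * (\sum_(i < n) x ^+ i) = 1.
  by have := subrX1 x n; rewrite xn0 sub0r -opprB mulNr => /oppr_inj.
by rewrite -cx h.
Qed.

Section Subring.
Variable S : set R.
Hypothesis hS : subring S.

Lemma subring0 : S 0.
Proof. by case: hS => S1 SB _; rewrite -(subrr 1); apply: SB. Qed.

Lemma subringN x : S x -> S (- x).
Proof. by case: hS => S1 SB _ Sx; rewrite -sub0r; apply: SB => //; exact: subring0. Qed.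

Lemma subringD x y : S x -> S y -> S (x + y).
Proof.
case: hS => S1 SB _ Sx Sy; rewrite -[y]opprK.
by apply: SB => //; apply: subringN.
Qed.

Lemma subringX x n : S x -> S (x ^+ n).
Proof. by case: hS => S1 _ SM Sx; elim: n => // n IH; rewrite exprS; apply: SM. Qed.

Lemma subring_commutator x y : S x -> S y -> S (commutator x y).
Proof. by case: hS => S1 SB SM Sx Sy; apply: SB; apply: SM. Qed.

(** For an idempotent [e], the products [e y (1 - e)] and [(1 - e) y e] square
    to [0]; being central they commute with [e], hence vanish. *)
Lemma idempotent_commutes e :
    (forall x, S x -> nilpotent x -> commutes_with S x) ->
  S e -> e * e = e -> commutes_with S e.
Proof.
move=> nilC Se ee y Sy; case: (hS) => S1 SB SM.
have ef0 : e * (1 - e) = 0 by rewrite mulrBr mulr1 ee subrr.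
have fe0 : (1 - e) * e = 0 by rewrite mulrBl mul1r ee subrr.
have Sf : S (1 - e) by apply: SB.
have /nilC : S (e * y * (1 - e)) by apply: (SM) => //; apply: (SM).
have /nilC : S ((1 - e) * y * e) by apply: (SM) => //; apply: (SM).
move=> /(_ _ e Se) c1 /(_ _ e Se) c2.
have {c2} : e * (e * y * (1 - e)) = 0.
  rewrite -c2; first by rewrite -mulrA fe0 mulr0.
  by exists 2%N; rewrite expr2 !mulrA -(mulrA _ (1 - e)) fe0 mulr0 !mul0r.
rewrite !mulrA ee mulrBr mulr1 => /subr0_eq ->.
have {c1} : (1 - e) * y * e * e = 0.
  rewrite c1; first by rewrite !mulrA ef0 !mul0r.
  by exists 2%N; rewrite expr2 !mulrA -(mulrA _ e) ef0 mulr0 !mul0r.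
by rewrite -mulrA ee mulrBl mul1r mulrBl => /subr0_eq ->.
Qed.

End Subring.

End Nilpotent.

(** * Finite rings whose nilpotent elements are central *)

(** A proper two-sided ideal of a finite subring of [R], bundled so that the
    quotient can carry canonical structures. *)
Record finite_ideal (R : nzRingType) := FiniteIdeal {
  fi_ring : seq R;
  fi_ideal : {pred R};
  fi_ring1 : 1 \in fi_ring;
  fi_ringB : forall x y, x \in fi_ring -> y \in fi_ring -> x - y \in fi_ring;
  fi_ringM : forall x y, x \in fi_ring -> y \in fi_ring -> x * y \in fi_ring;
  fi_ideal0 : 0 \in fi_ideal;
  fi_idealB : forall x y, x \in fi_ideal -> y \in fi_ideal -> x - y \in fi_ideal;
  fi_idealMl : forall x y, x \in fi_ring -> y \in fi_ideal -> x * y \in fi_ideal;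
  fi_idealMr : forall x y, x \in fi_ring -> y \in fi_ideal -> y * x \in fi_ideal;
  fi_ideal1 : 1 \notin fi_ideal
}.

Section FiniteQuotient.
Variables (R : nzRingType) (Q : finite_ideal R).
Local Notation S := (fi_ring Q).
Local Notation I := (fi_ideal Q).
Implicit Types x y : R.

Definition fi_repr x : R := choose (fun y => (y \in S) && (x - y \in I)) x.

(** The quotient is realised on canonical representatives of the cosets, which
    makes it a finite type at once. *)
Definition fi_quot : Type := seq_sub [seq fi_repr x | x <- S].
HB.instance Definition _ := Finite.on fi_quot.
Implicit Types a b c : fi_quot.

Let fi_default : fi_quot := SeqSub (map_f fi_repr (fi_ring1 Q)).
Definition fi_pi x : fi_quot := insubd fi_default (fi_repr x).

Lemma fi_ring0 : 0 \in S.
Proof. by rewrite -(subrr 1) fi_ringB ?fi_ring1. Qed.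

Lemma fi_ringN x : x \in S -> - x \in S.
Proof. by move=> Sx; rewrite -sub0r fi_ringB ?fi_ring0. Qed.

Lemma fi_ringD x y : x \in S -> y \in S -> x + y \in S.
Proof. by move=> Sx Sy; rewrite -[y]opprK fi_ringB ?fi_ringN. Qed.

Lemma fi_idealN x : x \in I -> - x \in I.
Proof. by move=> Ix; rewrite -sub0r fi_idealB ?fi_ideal0. Qed.

Lemma fi_idealD x y : x \in I -> y \in I -> x + y \in I.
Proof. by move=> Ix Iy; rewrite -[y]opprK fi_idealB ?fi_idealN. Qed.

Lemma fi_reprP x : x \in S -> (fi_repr x \in S) && (x - fi_repr x \in I).
Proof.
move=> Sx; have := @chooseP R (fun y => (y \in S) && (x - y \in I)) x.
by apply; rewrite Sx subrr fi_ideal0.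
Qed.

Lemma fi_repr_eq x y :
  x \in S -> y \in S -> (fi_repr x = fi_repr y) <-> x - y \in I.
Proof.
move=> Sx Sy; split=> [e|Ixy].
  case/andP: (fi_reprP Sx) (fi_reprP Sy) => _ Ix /andP[_ Iy].
  have -> : x - y = (x - fi_repr x) - (y - fi_repr y).
    by rewrite e opprB addrA subrK.
  exact: fi_idealB.
have Iyx : y - x \in I by rewrite -opprB fi_idealN.
rewrite /fi_repr (@eq_choose _ _ (fun z => (z \in S) && (y - z \in I))).
  apply: choose_id; first by rewrite Sx Iyx.
  by rewrite Sy subrr fi_ideal0.
move=> z /=; congr (_ && _); apply/idP/idP=> Iz.
  by rewrite -(subrK x y) -addrA fi_idealD.
by rewrite -(subrK y x) -addrA fi_idealD.
Qed.

Lemma fi_val_pi x : x \in S -> val (fi_pi x) = fi_repr x.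
Proof. by move=> Sx; rewrite /fi_pi val_insubd map_f. Qed.

Lemma fi_pi_eq x y : x \in S -> y \in S -> (fi_pi x = fi_pi y) <-> x - y \in I.
Proof.
move=> Sx Sy; rewrite -fi_repr_eq // -!fi_val_pi //.
by split=> [->//|]; apply: val_inj.
Qed.

Lemma fi_valS a : val a \in S.
Proof.
by have /mapP[y Sy ->] := valP a; case/andP: (fi_reprP Sy).
Qed.

Lemma fi_valK a : fi_pi (val a) = a.
Proof.
apply: val_inj; rewrite fi_val_pi ?fi_valS //.
have /mapP[y Sy ->] := valP a.
case/andP: (fi_reprP Sy) => Sry Iry.
by apply/fi_repr_eq => //; rewrite -opprB fi_idealN.
Qed.

Lemma fi_piP a : exists2 x, x \in S & a = fi_pi x.
Proof. by exists (val a); rewrite ?fi_valS ?fi_valK. Qed.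

Lemma fi_pi_sub x : x \in S -> x - val (fi_pi x) \in I.
Proof. by move=> Sx; rewrite fi_val_pi //; case/andP: (fi_reprP Sx). Qed.

Definition fi_add a b := fi_pi (val a + val b).
Definition fi_opp a := fi_pi (- val a).
Definition fi_mul a b := fi_pi (val a * val b).

Lemma fi_addE x y :
  x \in S -> y \in S -> fi_add (fi_pi x) (fi_pi y) = fi_pi (x + y).
Proof.
move=> Sx Sy; apply/fi_pi_eq; rewrite ?fi_ringD ?fi_valS //.
rewrite opprD addrACA -[_ - x]opprB -[_ - y]opprB.
by rewrite fi_idealD // fi_idealN ?fi_pi_sub.
Qed.

Lemma fi_oppE x : x \in S -> fi_opp (fi_pi x) = fi_pi (- x).
Proof.
move=> Sx; apply/fi_pi_eq; rewrite ?fi_ringN ?fi_valS //.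
by rewrite opprK addrC fi_pi_sub.
Qed.

Lemma fi_mulE x y :
  x \in S -> y \in S -> fi_mul (fi_pi x) (fi_pi y) = fi_pi (x * y).
Proof.
move=> Sx Sy; apply/fi_pi_eq; rewrite ?fi_ringM ?fi_valS //.
rewrite -opprB fi_idealN //.
have -> : x * y - val (fi_pi x) * val (fi_pi y) =
    x * (y - val (fi_pi y)) + (x - val (fi_pi x)) * val (fi_pi y).
  by rewrite mulrBr mulrBl addrA subrK.
by apply: fi_idealD; [apply: fi_idealMl|apply: fi_idealMr];
  rewrite ?fi_valS ?fi_pi_sub.
Qed.

Let fiE := (fi_addE, fi_oppE, fi_mulE).
Let fiS := (fi_ring1 Q, fi_ring0, fi_ringD, fi_ringN, fi_ringM).

Lemma fi_addA : associative fi_add.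
Proof.
move=> a b c; have [[[x Sx ->] [y Sy ->]] [z Sz ->]] := (fi_piP a, fi_piP b, fi_piP c).
by rewrite !fiE ?fiS // addrA.
Qed.

Lemma fi_addC : commutative fi_add.
Proof. by move=> a b; rewrite /fi_add addrC. Qed.

Lemma fi_add0 : left_id (fi_pi 0) fi_add.
Proof. by move=> a; have [x Sx ->] := fi_piP a; rewrite !fiE ?fiS // add0r. Qed.

Lemma fi_addN : left_inverse (fi_pi 0) fi_opp fi_add.
Proof. by move=> a; have [x Sx ->] := fi_piP a; rewrite !fiE ?fiS // addNr. Qed.

HB.instance Definition _ :=
  GRing.isZmodule.Build fi_quot fi_addA fi_addC fi_add0 fi_addN.

Lemma fi_mulA : associative fi_mul.
Proof.
move=> a b c; have [[[x Sx ->] [y Sy ->]] [z Sz ->]] := (fi_piP a, fi_piP b, fi_piP c).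
by rewrite !fiE ?fiS // mulrA.
Qed.

Lemma fi_mul1 : left_id (fi_pi 1) fi_mul.
Proof. by move=> a; have [x Sx ->] := fi_piP a; rewrite !fiE ?fiS // mul1r. Qed.

Lemma fi_mulr1 : right_id (fi_pi 1) fi_mul.
Proof. by move=> a; have [x Sx ->] := fi_piP a; rewrite !fiE ?fiS // mulr1. Qed.

Lemma fi_mulDl : left_distributive fi_mul fi_add.
Proof.
move=> a b c; have [[[x Sx ->] [y Sy ->]] [z Sz ->]] := (fi_piP a, fi_piP b, fi_piP c).
by rewrite !fiE ?fiS // mulrDl.
Qed.

Lemma fi_mulDr : right_distributive fi_mul fi_add.
Proof.
move=> a b c; have [[[x Sx ->] [y Sy ->]] [z Sz ->]] := (fi_piP a, fi_piP b, fi_piP c).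
by rewrite !fiE ?fiS // mulrDr.
Qed.

Lemma fi_pi1_neq0 : fi_pi 1 != 0.
Proof.
apply/eqP => /(fi_pi_eq (fi_ring1 Q) fi_ring0).
by rewrite subr0 (negPf (fi_ideal1 Q)).
Qed.

HB.instance Definition _ := GRing.Zmodule_isNzRing.Build fi_quot
  fi_mulA fi_mul1 fi_mulr1 fi_mulDl fi_mulDr fi_pi1_neq0.
HB.instance Definition _ := FinRing.isNzRing.Build fi_quot.

(** Wedderburn's little theorem, read modulo a completely prime ideal. *)
Lemma finite_prime_quotient_commutator :
    (forall x y, x \in S -> y \in S -> x * y \in I -> (x \in I) || (y \in I)) ->
  forall x y, x \in S -> y \in S -> commutator x y \in I.
Proof.
move=> primeI x y Sx Sy.
have pi0 z : z \in S -> (fi_pi z == 0) = (z \in I).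
  move=> Sz; apply/eqP/idP => [/(fi_pi_eq Sz fi_ring0)|Iz]; first by rewrite subr0.
  by apply/(fi_pi_eq Sz fi_ring0); rewrite subr0.
have dom : GRing.integral_domain_axiom fi_quot.
  move=> a b; have [[u Su ->] [v Sv ->]] := (fi_piP a, fi_piP b).
  rewrite [_ * _]fi_mulE // => /eqP; rewrite !pi0 ?fiS //.
  exact: primeI.
apply/fi_pi_eq; rewrite ?fi_ringM // -!fi_mulE //.
exact: (finDomain_mulrC dom).
Qed.

End FiniteQuotient.

Section FiniteRing.
Variable R : nzRingType.
Implicit Types (S : set R) (x y e f g : R).

(** Once [x ^+ i = x ^+ (i + d)], every multiple of [d] beyond [i] is an
    idempotent exponent. *)
Lemma idempotent_power x : finite_set (range (fun n => x ^+ n)) ->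
  exists m, x ^+ m.+1 * x ^+ m.+1 = x ^+ m.+1.
Proof.
move=> /finite_range_repeat[i [d xid]].
have per k : x ^+ (i + k * d.+1) = x ^+ i.
  by elim: k => [|k IH]; rewrite ?addn0 // mulSn addnA exprD -xid -exprD.
exists (i * d.+1 + d)%N; rewrite -addnS -mulSnr.
set m := (i.+1 * d.+1)%N; have le_im : (i <= m)%N 
  by apply: leq_trans (leqnSn i) _; rewrite leq_pmulr.
by rewrite -{1 3}(subnK le_im) !exprD -mulrA -exprD per.
Qed.

Lemma idempotent_expr e n : e * e = e -> e ^+ n.+1 = e.
Proof. by move=> ee; elim: n => [|n IH]; rewrite ?expr1 // exprS IH. Qed.

Lemma idempotent_nilpotent e : e * e = e -> nilpotent e -> e = 0.
Proof.
move=> ee [[|n]]; last by rewrite idempotent_expr.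
by rewrite expr0 => /eqP; rewrite oner_eq0.
Qed.

Lemma expr_idempotentD x e f n :
    x * e = e * x -> e * e = e -> f * f = f -> e * f = 0 -> f * e = 0 ->
  (x * e + f) ^+ n.+1 = x ^+ n.+1 * e + f.
Proof.
move=> xe ee ff ef fe; elim: n => [|n IH]; first by rewrite !expr1.
rewrite exprSr IH mulrDl !mulrDr ff -(mulrA _ e f) ef mulr0 addr0.
rewrite {2}xe (mulrA f) fe mul0r add0r; congr (_ + _).
by rewrite -mulrA (mulrA e x e) -xe -(mulrA x e e) ee mulrA -exprSr.
Qed.

Section Local.
Variable S : set R.
Hypotheses (hS : subring S) (Sfin : finite_set S).
Hypothesis nilC : forall x, S x -> nilpotent x -> commutes_with S x.

Let S1 : S 1. Proof. by case: hS. Qed.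
Let SB x y : S x -> S y -> S (x - y). Proof. by case: hS => _ + _; apply. Qed.
Let SM x y : S x -> S y -> S (x * y). Proof. by case: hS => _ _; apply. Qed.
Let SX x n : S x -> S (x ^+ n). Proof. exact: subringX. Qed.
Let idemC e : S e -> e * e = e -> commutes_with S e.
Proof. exact: idempotent_commutes. Qed.

Lemma finite_subring_powers x : S x -> finite_set (range (fun n => x ^+ n)).
Proof. by move=> Sx; apply: sub_finite_set Sfin => _ [n _ <-]; apply: SX. Qed.

(** A primitive idempotent below [e]: minimise the number of fixed points of
    right multiplication by [f]. *)
Lemma primitive_idempotent e : S e -> e * e = e -> e != 0 ->
  exists f, [/\ S f, f * f = f, e * f = f, f != 0 &
    forall g, S g -> g * g = g -> f * g = 0 \/ f * g = f].
Proof.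
move=> Se ee e0; have [s sP] := (finite_seqP S).1 Sfin.
pose P f := [/\ S f, f * f = f, e * f = f & f != 0].
pose mu f := count (fun z => z * f == z) s.
have exP : exists n, `[< exists2 f, P f & mu f = n >].
  by exists (mu e); apply/asboolP; exists e.
case: (ex_minnP exP) => n /asboolP[f [Sf ff ef f0] <-] minf.
exists f; split=> // g Sg gg; have [->|h0] := eqVneq (f * g) 0; [by left|right].
set h := f * g in h0 *.
have hf : h * f = h by rewrite /h -mulrA (idemC Sg) // mulrA ff.
have hh : h * h = h by rewrite {2}/h mulrA hf /h -mulrA gg.
have : (mu f <= mu h)%N.
  apply: minf; apply/asboolP; exists h => //.
  by split=> //; [exact: SM | rewrite /h mulrA ef].
have -> : mu h = count (fun z => z * h == z) [seq z <- s | z * f == z].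
  rewrite count_filter; apply: eq_count => z /=.
  apply/eqP/andP => [zh|[/eqP//]].
  by split; apply/eqP => //; rewrite -zh -mulrA hf.
rewrite /mu -size_filter => le_fh.
have /allP/(_ f) : all (fun z => z * h == z) [seq z <- s | z * f == z].
  by rewrite all_count eqn_leq count_size.
rewrite mem_filter ff eqxx /= => fh.
have /fh/eqP : f \in s by move: Sf; rewrite sP.
by rewrite /h mulrA ff.
Qed.

(** Below a primitive idempotent [f] every element is nilpotent or invertible,
    so the elements [x] with [x * f] nilpotent form a completely prime ideal;
    by Wedderburn it contains every commutator.  A commutator that is not
    nilpotent has a non-zero idempotent power, and taking [f] below that power
    gives a contradiction. *)
Lemma finite_commutator_nilpotent x y :
  S x -> S y -> nilpotent (commutator x y).
Proof.
move=> Sx Sy; set c := commutator x y.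
have Sc : S c by apply: subring_commutator.
have [m em] := idempotent_power (finite_subring_powers Sc).
apply: contrapT => cN.
have e0 : c ^+ m.+1 != 0 by apply/eqP => e0; apply: cN; exists m.+1.
have [f [Sf ff ef f0 fprim]] := primitive_idempotent (SX _ Sc) em e0.
have fC := idemC Sf ff.
have [s sP] := (finite_seqP S).1 Sfin.
have inS z : (z \in s) <-> S z by rewrite sP.
(* The preimage of the nil radical of the local ring [f * S]. *)
pose I : {pred R} := fun z => (z \in s) && `[< nilpotent (z * f) >].
have IP z : z \in I <-> S z /\ nilpotent (z * f).
  split=> [/andP[/inS Sz /asboolP //]|[Sz Nz]].
  by apply/andP; split; [apply/inS | apply/asboolP].
have fS : f \in s by apply/inS.
have Q1 : 1 \in s by apply/inS.
have QB u v : u \in s -> v \in s -> u - v \in s.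
  by move=> /inS Su /inS Sv; apply/inS; apply: SB.
have QM u v : u \in s -> v \in s -> u * v \in s.
  by move=> /inS Su /inS Sv; apply/inS; apply: SM.
have I0 : 0 \in I.
  by apply/IP; rewrite mul0r; split; [apply: subring0 | apply: nilpotent0].
have IB u v : u \in I -> v \in I -> u - v \in I.
  move=> /IP[Su Nu] /IP[Sv Nv]; apply/IP; split; first exact: SB.
  rewrite mulrBl; apply: nilpotentD => //; last exact: nilpotentN.
  by apply: nilC => //; [apply: SM | apply: subringN => //; apply: SM].
have IMl u v : u \in s -> v \in I -> u * v \in I.
  move=> /inS Su /IP[Sv Nv]; apply/IP; split; first exact: SM.
  have Cv : v * f * u = u * (v * f) by apply: nilC => //; apply: SM.
  by rewrite -mulrA -Cv; apply: nilpotentM.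
have IMr u v : u \in s -> v \in I -> v * u \in I.
  move=> /inS Su /IP[Sv Nv]; apply/IP; split; first exact: SM.
  rewrite -mulrA -(fC _ Su) mulrA; apply: nilpotentM => //.
  by apply: nilC => //; apply: SM.
have I1 : 1 \notin I.
  apply/negP => /IP[_]; rewrite mul1r => /(idempotent_nilpotent ff)/eqP.
  by rewrite (negPf f0).
pose Q := FiniteIdeal Q1 QB QM I0 IB IMl IMr I1.
have primeI u v : u \in s -> v \in s -> u * v \in I -> (u \in I) || (v \in I).
  move=> /inS Su /inS Sv /IP[_ Nuv]; apply/orP.
  have [k ek] := idempotent_power (finite_subring_powers Su).
  have [fu0|fuf] := fprim _ (SX _ Su) ek; [left|right]; apply/IP; split=> //.
    exists k.+1; rewrite exprMn_comm; last by rewrite /GRing.comm fC.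
    by rewrite (idempotent_expr _ ff) -fC //; apply: SX.
  have Suvf : S (u * v * f) by apply: (SM) => //; apply: SM.
  have -> : v * f = u * v * f * u ^+ k.
    rewrite (nilC Suvf Nuv); last exact: SX.
    rewrite !mulrA -exprSr (idemC (SX _ Su) ek) // -mulrA -(fC _ (SX _ Su)).
    by rewrite fuf.
  by apply: nilpotentM => //; apply: nilC => //; apply: SX.
have /IP[_ Nc] := finite_prime_quotient_commutator (Q := Q) primeI
  ((inS _).2 Sx) ((inS _).2 Sy).
have Scf : S (c * f) by apply: SM.
suff /(idempotent_nilpotent ff)/eqP : nilpotent f by rewrite (negPf f0).
rewrite -ef exprSr -mulrA -(nilC Scf Nc); last exact: SX.
by apply: nilpotentM => //; apply: nilC => //; apply: SX.
Qed.

Lemma commutatorXl x y n : x * commutator x y = commutator x y * x ->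
  commutator (x ^+ n.+1) y = commutator x y * x ^+ n *+ n.+1.
Proof.
set c := commutator x y => xc; elim: n => [|n IH].
  by rewrite expr1 mulr1.
have -> : commutator (x ^+ n.+2) y =
    x * commutator (x ^+ n.+1) y + c * x ^+ n.+1.
  by rewrite /c /commutator exprS mulrBr mulrBl !mulrA subrKA.
by rewrite IH mulrnAr mulrA xc -mulrA -exprS [RHS]mulrSr.
Qed.

Lemma pchar_exprB_comm (p : nat) x y i : p \in [pchar R] -> GRing.comm x y ->
  (x - y) ^+ (p ^ i) = x ^+ (p ^ i) - y ^+ (p ^ i).
Proof.
move=> pR cxy; elim: i => [|i IH]; first by rewrite expn0 !expr1.
rewrite expnSr !exprM IH -!(pFrobenius_autE pR) pFrobenius_autB_comm //.
by apply/commr_sym/commrX/commr_sym/commrX.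
Qed.

(** Herstein's theorem in characteristic [p].  Since the [p]-power powers of
    [x] repeat, [x - x ^+ q] is nilpotent for some power [q] of [p]; hence
    [commutator x y] equals [commutator (x ^+ q) y], a multiple of [q] because
    [commutator x y], being nilpotent, is central. *)
Theorem finite_nilpotent_central_commutative (p : nat) x y :
  p \in [pchar R] -> S x -> S y -> x * y = y * x.
Proof.
move=> pR Sx Sy; set c := commutator x y.
have cC : commutes_with S c.
  by apply: nilC; [exact: subring_commutator | exact: finite_commutator_nilpotent].
have [i [d e]] : exists i d, x ^+ (p ^ i) = x ^+ (p ^ (i + d.+1)).
  apply: (@finite_range_repeat R (fun n => x ^+ (p ^ n))).
  by apply: sub_finite_set Sfin => _ [n _ <-]; apply: SX.
have xN : nilpotent (x - x ^+ (p ^ d.+1)).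
  exists (p ^ i)%N; rewrite (pchar_exprB_comm _ pR); last exact: commrX.
  by rewrite -exprM -expnD addnC -e subrr.
have p_gt0 : (0 < p)%N by rewrite prime_gt0 // (pcharf_prime pR).
have [q qE] : exists q, (p ^ d.+1 = q.+1)%N.
  by exists (p ^ d.+1).-1; rewrite prednK // expn_gt0 p_gt0.
have xqC : commutator (x ^+ (p ^ d.+1)) y = 0.
  rewrite qE commutatorXl; last by rewrite cC.
  by rewrite -mulr_natr -qE natrX (pcharf0 pR) expr0n mulr0.
have := nilC (SB Sx (SX (p ^ d.+1) Sx)) xN Sy.
rewrite mulrBl mulrBr => xqy; apply: (addIr (- (y * x ^+ (p ^ d.+1)))).
by rewrite -xqy (subr0_eq xqC).
Qed.

End Local.
End FiniteRing.

(** * Finitely generated torsion monoids with finitely many conjugates *)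

Section Dietzmann.
Variables (R : nzRingType) (X : seq R).
Implicit Types (w : seq R) (l : seq R).

Hypothesis conjX : {in X &, forall x y, exists2 z, z \in X & y * x = x * z}.
Hypothesis torsX : {in X, forall x, finite_set (range (fun n => x ^+ n))}.

Definition words : set R :=
  [set \prod_(y <- w) y | w in [set w : seq R | {subset w <= X}]].

Fixpoint ordered_products l : set R :=
  if l is x :: l'
  then [set a * b | a in range (fun n => x ^+ n) & b in ordered_products l']
  else [set 1].

Lemma finite_ordered_products l :
  {subset l <= X} -> finite_set (ordered_products l).
Proof.
elim: l => [|x l IH] lX; first exact: finite_set1.
by apply: finite_image2; [apply: torsX; apply: lX; rewrite inE eqxx |
  apply: IH => y yl; apply: lX; rewrite inE yl orbT].
Qed.

(** Each letter [y] that [x] passes is replaced by the conjugate [z] with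
    [y * x = x * z], so that the length does not change. *)
Lemma move_to_front x w : x \in X -> {subset w <= X} -> x \in w ->
  exists w', [/\ {subset w' <= X}, size w = (size w').+1 &
    \prod_(y <- w) y = x * \prod_(y <- w') y].
Proof.
move=> xX; elim: w => // y w IH /allP/= /andP[yX /allP wX].
have [->|nexy] := eqVneq x y; first by exists w; rewrite big_cons.
rewrite inE (negPf nexy) /= => /(IH wX)[w' [w'X -> e]].
have [z zX yx] := conjX xX yX; exists (z :: w'); split=> //.
  by apply/allP => /=; rewrite zX; apply/allP.
by rewrite !big_cons e !mulrA yx.
Qed.

(** Words are sorted by moving to the front, as long as possible, the first
    letter of [l]; when no word of the same length and value contains that
    letter any more, the next letter is treated.  Fixing the length is what
    makes this terminate. *)
Lemma word_ordered l n w : {subset w <= X} -> size w = n ->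
    (forall w', {subset w' <= X} -> size w' = n ->
       \prod_(y <- w') y = \prod_(y <- w) y -> {subset w' <= l}) ->
  ordered_products l (\prod_(y <- w) y).
Proof.
elim: l n w => [|x l IHl] n w wX sw wl.
  case: w wX sw wl => [|y w] wX sw wl; first by rewrite big_nil.
  by have := wl _ wX sw erefl y; rewrite inE eqxx => /(_ isT).
elim: n w wX sw wl => [|n IHn] w wX sw wl.
  exists 1; first by exists 0%N.
  exists 1; last by rewrite mulr1 (size0nil sw) big_nil.
  have := IHl 0%N [::]; rewrite big_nil; apply=> // w' _ /size0nil -> _.
  by move=> y; rewrite inE.
have [[w1 [w1X sw1 ew1 xw1]]|nox] := pselect (exists w1,
   [/\ {subset w1 <= X}, size w1 = n.+1,
       \prod_(y <- w1) y = \prod_(y <- w) y & x \in w1]).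
  have xX := w1X _ xw1.
  have [w2 [w2X sw2 ew2]] := move_to_front xX w1X xw1.
  have sw2n : size w2 = n by move: sw2; rewrite sw1 => -[].
  have [_ [k _ <-] [b lb e]] : ordered_products (x :: l) (\prod_(y <- w2) y).
    apply: IHn => // w3 w3X sw3 ew3 z zw3.
    apply: (wl (x :: w3)); rewrite ?inE ?zw3 ?orbT //=.
    - by apply/allP => /=; rewrite xX; apply/allP.
    - by rewrite sw3.
    - by rewrite big_cons ew3 -ew2.
  exists (x ^+ k.+1); first by exists k.+1.
  by exists b => //; rewrite -ew1 ew2 -e exprS mulrA.
exists 1; first by exists 0%N.
exists (\prod_(y <- w) y); last by rewrite mul1r.
apply: (IHl n.+1) => // w' w'X sw' ew' z zw'.
have := wl _ w'X sw' ew' z zw'; rewrite inE => /orP[/eqP zx|//].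
by case: nox; exists w'; rewrite -zx.
Qed.

Lemma finite_words : finite_set words.
Proof.
apply: sub_finite_set (finite_ordered_products (l := X) _) => //.
by move=> _ [w wX <-]; apply: (@word_ordered X (size w)).
Qed.

Lemma words1 : words 1.
Proof. by exists [::]; rewrite ?big_nil // => y; rewrite inE. Qed.

Lemma wordsM : forall a b, words a -> words b -> words (a * b).
Proof.
move=> _ _ [u uX <-] [v vX <-]; exists (u ++ v); last by rewrite big_cat.
by move=> y; rewrite mem_cat => /orP[/uX|/vX].
Qed.

Lemma words_letter x : x \in X -> words x.
Proof.
by move=> xX; exists [:: x]; rewrite ?big_seq1 // => y; rewrite inE => /eqP->.
Qed.

Lemma words_sub (S : set R) : subring S -> (forall x, x \in X -> S x) -> words `<=` S.
Proof.
move=> [S1 _ SM] XS _ [w wX <-].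
elim: w wX => [|y w IH] wX; rewrite ?big_nil ?big_cons //.
apply: SM; first by apply/XS/wX; rewrite inE eqxx.
by apply: IH => z zw; apply: wX; rewrite inE zw orbT.
Qed.

End Dietzmann.

(** * Linear spans and algebraic elements *)

Section Span.
Variables (F : fieldType) (R : algType F).
Implicit Types (s t l : seq R) (S V : set R) (a x y z : R) (c : F).

Fixpoint lspan s : set R :=
  if s is x :: s' then [set c *: x + v | c in [set: F] & v in lspan s']
  else [set 0].

Lemma lspan_linear s c x y : lspan s x -> lspan s y -> lspan s (c *: x + y).
Proof.
elim: s x y => [|a s IH] x y /=; first by move=> -> ->; rewrite scaler0 addr0.
move=> [c1 _ [v1 sv1 <-]] [c2 _ [v2 sv2 <-]].
exists (c * c1 + c2) => //; exists (c *: v1 + v2); first exact: IH.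
by rewrite scalerDl scalerDr scalerA addrACA.
Qed.

Lemma lspan0 s : lspan s 0.
Proof.
by elim: s => //= a s IH; exists 0 => //; exists 0; rewrite // scale0r addr0.
Qed.

Lemma lspanD s x y : lspan s x -> lspan s y -> lspan s (x + y).
Proof. by move=> sx sy; rewrite -[x]scale1r; apply: lspan_linear. Qed.

Lemma lspanZ s c x : lspan s x -> lspan s (c *: x).
Proof. by move=> sx; rewrite -[_ *: _]addr0; apply: lspan_linear => //; apply: lspan0. Qed.

Lemma lspan_mem s x : x \in s -> lspan s x.
Proof.
elim: s => //= a s IH; rewrite inE => /orP[/eqP->|/IH sx].
  by exists 1 => //; exists 0; rewrite ?scale1r ?addr0 //; apply: lspan0.
by exists 0 => //; exists x => //; rewrite scale0r add0r.
Qed.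

Lemma lspan_sub s V : V 0 -> (forall c x y, V x -> V y -> V (c *: x + y)) ->
  {in s, forall x, V x} -> lspan s `<=` V.
Proof.
move=> V0 VL; elim: s => [|a s IH] sV; first by move=> _ ->.
move=> _ [c _ [v sv <-]]; apply: VL; first by apply: sV; rewrite inE eqxx.
by apply: IH sv => x xs; apply: sV; rewrite inE xs orbT.
Qed.

Lemma lspanM s t u x y :
    (forall a b, a \in s -> b \in t -> lspan u (a * b)) ->
  lspan s x -> lspan t y -> lspan u (x * y).
Proof.
move=> stu sx ty.
move: x sx; apply: (@lspan_sub s [set z | lspan u (z * y)]) => /= [|c x1 x2|a sa];
  first by rewrite mul0r; apply: lspan0.
  by move=> h1 h2; rewrite mulrDl -scalerAl; apply: lspan_linear.
move: y ty; apply: (@lspan_sub t [set z | lspan u (a * z)]) => /= [|c x1 x2|b tb];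
  first by rewrite mulr0; apply: lspan0.
  by move=> h1 h2; rewrite mulrDr -scalerAr; apply: lspan_linear.
exact: stu.
Qed.

Lemma lspan_sum s (I : Type) (r : seq I) (f : I -> R) :
  (forall i, lspan s (f i)) -> lspan s (\sum_(i <- r) f i).
Proof.
by move=> sf; elim/big_rec: _ => [|i x _ sx]; [apply: lspan0|apply: lspanD].
Qed.

Lemma lspan_finite s : finite_set [set: F] -> finite_set (lspan s).
Proof.
move=> Ffin; elim: s => [|a s IH]; first exact: finite_set1.
exact: finite_image2.
Qed.

Lemma lspanE s :
  lspan s = [set \sum_(i < size s) c i *: s`_i | c in [set: 'I_(size s) -> F]].
Proof.
elim: s => [|a s IH].
  apply/seteqP; split=> [_ -> | _ [c _ <-]]; last by rewrite big_ord0.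
  by exists (fun _ => 0) => //; rewrite big_ord0.
rewrite [LHS]/= IH; apply/seteqP; split=> [_ [c _ [_ [d _ <-] <-]] | _ [c _ <-]].
  exists (fun i => if unlift ord0 i is Some j then d j else c) => //.
  rewrite big_ord_recl unlift_none; congr (_ + _).
  by apply: eq_bigr => i _; rewrite liftK.
exists (c ord0) => //; exists (\sum_(i < size s) c (lift ord0 i) *: s`_i).
  by exists (fun i => c (lift ord0 i)).
by rewrite big_ord_recl.
Qed.

Lemma is_subalgebraP S : S 1 -> (forall c x y, S x -> S y -> S (c *: x + y)) ->
  (forall x y, S x -> S y -> S (x * y)) -> is_subalgebra S.
Proof.
move=> S1 SL SM; split; first by apply/mem_set.
  by move=> c x y /set_mem Sx /set_mem Sy; apply/mem_set; apply: SL.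
by move=> x y /set_mem Sx /set_mem Sy; apply/mem_set; apply: SM.
Qed.

Lemma is_subalgebra_elim S : is_subalgebra S ->
  [/\ S 1, forall c x y, S x -> S y -> S (c *: x + y)
    & forall x y, S x -> S y -> S (x * y)].
Proof.
case=> /set_mem S1 SL SM; split=> // [c x y Sx Sy|x y Sx Sy]; apply: set_mem.
  by apply: SL; apply/mem_set.
by apply: SM; apply/mem_set.
Qed.

Lemma subalgebra_subring S : is_subalgebra S -> subring S.
Proof.
move=> /is_subalgebra_elim[S1 SL SM]; split=> // x y Sx Sy.
by rewrite -scaleN1r addrC; apply: SL.
Qed.

Lemma horner_alg_sum a (p : {poly F}) :
  horner_alg a p = \sum_(i < size p) p`_i *: a ^+ i.
Proof.
rewrite -{1}[p]coefK poly_def linear_sum /=; apply: eq_bigr => i _.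
by rewrite linearZ /= rmorphXn /= horner_algX mulr_algl.
Qed.

Lemma lspan_powers a : is_algebraic a ->
  exists d, forall n, lspan [seq a ^+ i | i <- iota 0 d] (a ^+ n).
Proof.
move=> [p p0 pa0]; exists (size p) => n.
have -> : a ^+ n = horner_alg a ('X^n %% p).
  transitivity (horner_alg a 'X^n); first by rewrite rmorphXn /= horner_algX.
  rewrite {1}(divp_eq 'X^n p).
  by rewrite rmorphD rmorphM /= pa0 mulr0 add0r.
rewrite horner_alg_sum; apply: lspan_sum => i; apply: lspanZ; apply: lspan_mem.
rewrite map_f // mem_iota /= add0n (leq_trans (ltn_ord i)) // ltnW //.
by rewrite ltn_modp.
Qed.

(** More powers than spanning vectors: the coordinate matrix has a row
    relation. *)
Lemma lspan_algebraic s a : (forall n, lspan s (a ^+ n)) -> is_algebraic a.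
Proof.
move=> sa; have cP n : exists c : 'I_(size s) -> F, \sum_(i < size s) c i *: s`_i = a ^+ n.
  by have := sa n; rewrite lspanE => -[c _ <-]; exists c.
have [c cE] := choice cP.
pose M := \matrix_(i < (size s).+1, j < size s) c i j.
have : kermx M != 0.
  by rewrite -mxrank_eq0 mxrank_ker subn_eq0 -ltnNge ltnS rank_leq_col.
case/rowV0Pn => u /sub_kermxP uM u0.
exists (\poly_(i < (size s).+1) u 0 (inord i)).
  apply: contra u0 => /eqP p0; apply/eqP/rowP => i; rewrite mxE.
  have := coef_poly (size s).+1 (fun i => u 0 (inord i)) i.
  by rewrite p0 coef0 ltn_ord inord_val => <-.
rewrite poly_def linear_sum /=.
transitivity (\sum_(i < (size s).+1) \sum_(j < size s) (u 0 i * M i j) *: s`_j).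
  apply: eq_bigr => i _; rewrite linearZ /= rmorphXn /= horner_algX mulr_algl -cE scaler_sumr.
  by apply: eq_bigr => j _; rewrite scalerA inord_val mxE.
rewrite exchange_big big1 //= => j _; rewrite -scaler_suml.
by have /rowP/(_ j) := uM; rewrite !mxE => ->; rewrite scale0r.
Qed.

Lemma is_algebraic_nilpotent a : nilpotent a -> is_algebraic a.
Proof.
case=> n an0; exists 'X^n; first by rewrite -size_poly_eq0 size_polyXn.
by rewrite rmorphXn /= horner_algX.
Qed.

(** Ordered monomials with bounded exponents suffice, because every power of an
    algebraic element is a combination of finitely many.  The last clause says
    that these monomials lie in the subalgebra generated by [l]; applied to the
    centralizer of the next element it gives the induction step. *)
Lemma commuting_algebraic_span l :
    {in l, forall x, is_algebraic x} -> {in l &, forall x y, x * y = y * x} ->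
  exists s, [/\ is_subalgebra (lspan s), {in l, forall x, lspan s x} &
    forall S, is_subalgebra S -> {in l, forall x, S x} -> {in s, forall x, S x}].
Proof.
elim: l => [|x l IH] alg comm.
  exists [:: 1]; split=> //; last first.
    by move=> S /is_subalgebra_elim[S1 _ _] _ y; rewrite inE => /eqP->.
  apply: is_subalgebraP; [by apply: lspan_mem; rewrite inE|exact: lspan_linear|].
  move=> y z; apply: lspanM => a b; rewrite !inE => /eqP-> /eqP->.
  by rewrite mulr1; apply: lspan_mem; rewrite inE.
have sub_xl y : y \in l -> y \in x :: l by rewrite inE => ->; rewrite orbT.
have algl : {in l, forall y, is_algebraic y} by move=> y /sub_xl/alg.
have comml : {in l &, forall y z, y * z = z * y}.
  by move=> y z yl zl; apply: comm; apply: sub_xl.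
have [s [sA ls smin]] := IH algl comml.
have [d powx] := lspan_powers (alg x (mem_head _ _)).
have [s1 sL sM] := is_subalgebra_elim sA.
pose t := [seq x ^+ i | i <- iota 0 d].
pose r := [seq v * w | v <- s, w <- t].
have rM a b : lspan s a -> lspan t b -> lspan r (a * b).
  by apply: lspanM => v w sv tw; apply: lspan_mem; apply: allpairs_f.
have sx v : v \in s -> v * x = x * v.
  move=> sv; apply: (smin [set v | v * x = x * v] _ _ v sv).
    apply: is_subalgebraP => /= [|c y z ey ez|y z ey ez].
    - by rewrite mul1r mulr1.
    - by rewrite mulrDl mulrDr -scalerAl -scalerAr ey ez.
    - by rewrite -mulrA ez mulrA ey mulrA.
  by move=> y yl; apply: comm; rewrite ?mem_head ?sub_xl.
exists r; split.
- apply: is_subalgebraP; last 2 first.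
  + exact: lspan_linear.
  + move=> y z; apply: lspanM => a b /allpairsP[[v1 w1] /= [sv1 tw1 ->]].
    move=> /allpairsP[[v2 w2] /= [sv2 tw2 ->]].
    have /mapP[i _ ->] := tw1; have /mapP[j _ ->] := tw2.
    rewrite mulrA -(mulrA v1) -(commrX _ (sx v2 sv2)) mulrA -mulrA -exprD.
    by apply: rM; [apply: sM; apply: lspan_mem | apply: powx].
  + by rewrite -(mulr1 1); apply: rM => //; apply: (powx 0%N).
- move=> y; rewrite inE => /orP[/eqP->|/ls sy].
    by rewrite -(mul1r x); apply: rM => //; apply: (powx 1%N).
  by rewrite -(mulr1 y); apply: rM => //; apply: (powx 0%N).
- move=> S SA lS _ /allpairsP[[v _] /= [sv /mapP[i _ ->] ->]].
  have [S1 SL SM] := is_subalgebra_elim SA; apply: SM.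
    by apply: smin sv => // y /sub_xl/lS.
  by apply: subringX; [apply: subalgebra_subring | apply: lS; rewrite mem_head].
Qed.

End Span.

(** * The FC-subring and omega-subgroups *)

Section FCSubring.
Variable R : nzRingType.
Implicit Types (D H : set R) (a b g h k u v x y z : R).

Local Notation FC := (@fc_subring R).

(** Writing the conjugation equation as [u * a = z * u] avoids inverses. *)
Definition conjugates a : set R := [set z | exists2 u, unit_group u & u * a = z * u].

Lemma unit_group1 : unit_group (1 : R).
Proof. by exists 1; rewrite mulr1. Qed.

Lemma unit_groupM u v : unit_group u -> unit_group v -> unit_group (u * v).
Proof.
move=> [u' [u'u uu']] [v' [v'v vv']]; exists (v' * u').
by rewrite !mulrA -(mulrA v') u'u mulr1 v'v -(mulrA u) vv' mulr1.
Qed.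

Lemma unit_mulIr u x y : unit_group u -> x * u = y * u -> x = y.
Proof.
by move=> [v [_ uv]] /(congr1 ( *%R^~ v)); rewrite -!mulrA uv !mulr1.
Qed.

Lemma unit_mulIl u x y : unit_group u -> u * x = u * y -> x = y.
Proof.
by move=> [v [vu _]] /(congr1 ( *%R v)); rewrite !mulrA vu !mul1r.
Qed.

Lemma unit_conjugate u a : unit_group u -> exists2 z, conjugates a z & u * a = z * u.
Proof.
move=> Uu; have [v [vu _]] := Uu; exists (u * a * v); last by rewrite -mulrA vu mulr1.
by exists u => //; rewrite -mulrA vu mulr1.
Qed.

(** The left cosets of the centralizer of [a] correspond to its conjugates. *)
Lemma fcP a : FC a <-> finite_set (conjugates a).
Proof.
pose coset_of z : set R := [set u | unit_group u /\ u * a = z * u].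
have cosetE u z : unit_group u -> u * a = z * u ->
    [set u * h | h in unit_centralizer a] = coset_of z.
  move=> Uu e; apply/seteqP; split=> [_ [h [Uh ha] <-]|w [Uw ew]].
    split; first exact: unit_groupM.
    by rewrite -mulrA ha !mulrA e.
  have [v [vu uv]] := Uu; exists (v * w); last by rewrite mulrA uv mul1r.
  split; first by apply: unit_groupM => //; exists u.
  rewrite -mulrA ew mulrA; have -> : v * z = a * v.
    by apply: (unit_mulIr Uu); rewrite -!mulrA vu mulr1 -e mulrA vu mul1r.
  by rewrite mulrA.
rewrite /fc_subring /=; split=> fin.
  have zP (K : set R) : exists z,
      (exists2 u, unit_group u /\ K u & u * a = z * u) \/
      ~ (exists2 u, unit_group u /\ K u & exists z, u * a = z * u).
    have [[u Ku [z e]]|nex] := pselect (exists2 u, unit_group u /\ K u & exists z, u * a = z * u).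
      by exists z; left; exists u.
    by exists 0; right.
  have [f fP] := choice zP; apply: sub_finite_set (finite_image f fin).
  move=> z [u Uu e]; exists [set u * h | h in unit_centralizer a]; first by exists u.
  have Ku : [set u * h | h in unit_centralizer a] u.
    by exists 1; [split; [apply: unit_group1 | rewrite mul1r mulr1] | rewrite mulr1].
  case: (fP [set u * h | h in unit_centralizer a]); last first.
    by case; exists u => //; exists z.
  case=> w [Uw]; rewrite (cosetE _ _ Uu e) => -[_ ew] e'.
  by apply: (unit_mulIr Uw); rewrite -e' -ew.
apply: sub_finite_set (finite_image coset_of fin) => K [u Uu <-].
have [z az e] := unit_conjugate a Uu; exists z => //.
by rewrite (cosetE _ _ Uu e).
Qed.

Lemma fc_central a : (forall u, unit_group u -> u * a = a * u) -> FC a.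
Proof.
move=> aC; apply/fcP; apply: (@sub_finite_set _ _ [set a]); last exact: finite_set1.
by move=> z [u Uu e]; apply: (unit_mulIr Uu); rewrite -e aC.
Qed.

Lemma fc_subring_subring : subring FC.
Proof.
split.
- by apply: fc_central => u _; rewrite mulr1 mul1r.
- move=> x y /fcP fx /fcP fy; apply/fcP.
  apply: sub_finite_set (finite_image2 (fun a b => a - b) fx fy) => z [u Uu e].
  have [a xa ea] := unit_conjugate x Uu; have [b yb eb] := unit_conjugate y Uu.
  exists a => //; exists b => //; apply: (unit_mulIr Uu).
  by rewrite -e mulrBl mulrBr ea eb.
- move=> x y /fcP fx /fcP fy; apply/fcP.
  apply: sub_finite_set (finite_image2 (fun a b => a * b) fx fy) => z [u Uu e].
  have [a xa ea] := unit_conjugate x Uu; have [b yb eb] := unit_conjugate y Uu.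
  exists a => //; exists b => //; apply: (unit_mulIr Uu).
  by rewrite -e [RHS]mulrA ea -[RHS]mulrA eb !mulrA.
Qed.

Let FC1 : FC 1. Proof. by case: fc_subring_subring. Qed.
Let FCM x y : FC x -> FC y -> FC (x * y).
Proof. by case: fc_subring_subring => _ _; apply. Qed.
Let FCX x n : FC x -> FC (x ^+ n).
Proof. move=> fx; exact (subringX fc_subring_subring n fx). Qed.

Lemma conjugates_refl a : conjugates a a.
Proof. by exists 1; [apply: unit_group1 | rewrite mul1r mulr1]. Qed.

Lemma conjugates_trans a b z : conjugates a b -> conjugates b z -> conjugates a z.
Proof.
move=> [u Uu e] [v Uv e']; exists (v * u); first exact: unit_groupM.
by rewrite -mulrA e mulrA e' mulrA.
Qed.

Lemma fc_conjugate a b : FC a -> conjugates a b -> FC b.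
Proof.
move=> /fcP fa ab; apply/fcP; apply: sub_finite_set fa => z.
exact: conjugates_trans.
Qed.

(** As [y] has finitely many conjugates, this is the pigeonhole principle. *)
Lemma fc_infinite_same_conjugate (T : Type) (D : set T) (g : T -> R) y :
    FC y -> infinite_set D -> (forall t, D t -> unit_group (g t)) ->
  exists z t, D t /\ infinite_set [set s | D s /\ g s * y = z * g s]
    /\ g t * y = z * g t.
Proof.
move=> /fcP fy Dinf Dg.
have zP t : exists z, D t -> conjugates y z /\ g t * y = z * g t.
  have [Dt|nDt] := pselect (D t); last by exists 0.
  by have [z yz e] := unit_conjugate y (Dg _ Dt); exists z.
have [f fP] := choice zP.
have [|t Dt inf] := infinite_fiber (f := f) Dinf.
  by apply: sub_finite_set fy => _ [t /fP[yt _] <-].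
exists (f t), t; split=> //; split; last by case: (fP t Dt).
apply: sub_infinite_set inf => s [Ds fs]; split=> //.
by rewrite -fs; case: (fP s Ds).
Qed.

Section Omega.
Variable H : set R.
Hypothesis omegaH : omega_subgroup H.

Let HU : H `<=` unit_group. Proof. by case: omegaH => -[]. Qed.

Lemma omega_quotient h k : H h -> H k -> exists2 h', H h' & k * h' = h.
Proof.
case: omegaH => -[_ _ HM HV] _ _ Hh Hk; have [v [vk kv]] := HU Hk.
by exists (v * h); [apply: (HM) => //; apply: (HV k) | rewrite mulrA kv mul1r].
Qed.

(** Two elements of the FC-subring have an infinite common centralizer in
    [H], since it has finite index. *)
Lemma omega_infinite_centralizer x y : FC x -> FC y ->
  infinite_set [set h | [/\ H h, h * x = x * h & h * y = y * h]].
Proof.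
have centr D z : D `<=` H -> infinite_set D -> FC z ->
    exists k, D k /\ infinite_set [set h | H h /\ D (k * h) /\ h * z = z * h].
  move=> DH Dinf fz.
  have [w [k [Dk [inf kw]]]] : exists w k, D k /\
      infinite_set [set s | D s /\ s * z = w * s] /\ k * z = w * k.
    by apply: (@fc_infinite_same_conjugate R D id z) => // t /DH/HU.
  exists k; split=> // fin; apply: inf.
  apply: sub_finite_set (finite_image ( *%R k) fin) => h [Dh hw].
  have [h' Hh' e] := omega_quotient (DH _ Dh) (DH _ Dk).
  exists h' => //; split=> //; rewrite e; split=> //.
  by apply: (unit_mulIl (HU (DH _ Dk))); rewrite !mulrA e kw hw -e mulrA.
move=> fx fy; have [_ Hinf _] := omegaH.
have [k [Hk inf]] := centr H x (fun _ => id) Hinf fx.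
pose D := [set h | H h /\ h * x = x * h].
have Dinf : infinite_set D.
  by apply: sub_infinite_set inf => h [Hh [_ hx]].
have [k' [[Hk' k'x] inf']] := centr D y (fun h => @proj1 _ _) Dinf fy.
apply: sub_infinite_set inf' => h [Hh [[_ khx] hy]]; split=> //.
by apply: (unit_mulIl (HU Hk')); rewrite mulrA khx !mulrA k'x.
Qed.

(** The defining property of an omega-subgroup, for differences [h - k]
    instead of [1 - h]: write [h - k = - k (1 - k^-1 h)]. *)
Lemma omega_commute D k x y : D `<=` H -> infinite_set D -> H k ->
  (forall h, D h -> h * commutator x y = k * commutator x y) -> x * y = y * x.
Proof.
move=> DH Dinf Hk Dc; apply/eqP; rewrite -subr_eq0 -[_ - _]/(commutator x y).
apply: contrapT => /negP c0; case: omegaH => _ _ /(_ _ _ c0) fin; apply: Dinf.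
apply: sub_finite_set (finite_image (fun r => k * (1 - r)) fin) => h Dh.
have [h' Hh' e] := omega_quotient (DH _ Dh) Hk.
exists (1 - h'); last by rewrite opprB addrC subrK.
split; last by exists h'.
rewrite /left_annihilator /= mulrBl mul1r; apply/eqP; rewrite subr_eq0; apply/eqP.
by apply: (unit_mulIl (HU Hk)); rewrite mulrA e Dc.
Qed.

(** By induction on the index of nilpotency [x ^+ 2] and [x ^+ 3] commute with
    [y], so that [c := [x, y]] satisfies [x * c = - (c * x)] and
    [x ^+ 2 * c = 0].  For [h] in the common centralizer of [x] and [y] the unit
    [1 + x * h] satisfies [(1 + x * h) * y = y * (1 + x * h) + c * h].
    Infinitely many [h] give the same conjugate [y + w], whence
    [w = c * h - c * x * h ^+ 2] does not depend on [h].  Multiplying by [x]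
    kills the quadratic term, and the omega property, applied first to
    [x * c = [x, x * y]] and then to [c], gives [c = 0]. *)
Lemma fc_nilpotent_central x : FC x -> nilpotent x -> commutes_with FC x.
Proof.
move=> fx [n]; elim: n x fx => [|n IH] x fx; first by move/eqP; rewrite expr0 oner_eq0.
move=> xn0 y fy; case: n => [|n] in IH xn0.
  by rewrite -[x]expr1 xn0 mul0r mulr0.
(* [m * n.+1 >= n.+2] for [m > 1], so [x ^+ m] has a smaller index. *)
have xm0 m : (1 < m)%N -> (x ^+ m) ^+ n.+1 = 0.
  move=> m_gt1; rewrite -exprM; apply: expr0_le xn0.
  by rewrite (leq_trans _ (leq_mul m_gt1 (leqnn n.+1))) // mul2n -addnn addSn ltnS leq_addl.
have x2y := IH _ (FCX 2 fx) (xm0 2%N isT) y fy.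
have x3y := IH _ (FCX 3 fx) (xm0 3%N isT) y fy.
set c := commutator x y.
have xc : x * c = - (c * x).
  by rewrite /c /commutator mulrBr mulrBl opprB mulrA -expr2 x2y expr2 !mulrA.
have x2c : x ^+ 2 * c = 0.
  by rewrite /c /commutator mulrBr !mulrA -exprSr x3y x2y -mulrA -exprSr subrr.
have cx2 : c * x ^+ 2 = 0.
  by rewrite expr2 mulrA -[c * x]opprK -xc mulNr -mulrA -[c * x]opprK -xc mulrN opprK mulrA -expr2.
pose C := [set h | [/\ H h, h * x = x * h & h * y = y * h]].
have Cinf : infinite_set C by apply: omega_infinite_centralizer.
have CU h : C h -> unit_group (1 + x * h).
  case=> Hh hx hy; rewrite -[x * h]opprK; apply: nilpotent_unit1B.
  by apply: nilpotentN; apply: nilpotentM => //; exists n.+2.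
have [z [k [Ck [inf zk]]]] := fc_infinite_same_conjugate fy Cinf CU.
(* Right multiplication by [1 - x * h] inverts [1 + x * h] up to [x ^+ 2], which
   [w] annihilates. *)
have wE h : C h -> (1 + x * h) * y = z * (1 + x * h) ->
    z - y = c * h - c * x * h ^+ 2.
  move=> Ch zh; have [Hh hx hy] := Ch; set w := z - y.
  have hc : h * x ^+ 2 = x ^+ 2 * h.
    by rewrite expr2 mulrA hx -mulrA hx mulrA.
  have w1 : w * (1 + x * h) = c * h.
    rewrite /w mulrBl -zh mulrDl mulrDr mul1r mulr1 [y + _]addrC addrKA /c /commutator mulrBl.
    by rewrite -!mulrA hy !mulrA.
  have wx2 : w * x ^+ 2 = 0.
    apply: (unit_mulIr (CU _ Ch)); rewrite mul0r -mulrA.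
    have -> : x ^+ 2 * (1 + x * h) = (1 + x * h) * x ^+ 2.
      rewrite mulrDl mulrDr mul1r mulr1; congr (_ + _).
      by rewrite -mulrA hc expr2 !mulrA.
    by rewrite mulrA w1 -mulrA hc mulrA cx2 mul0r.
  clearbody w; have -> : w = w * (1 + x * h) * (1 - x * h).
    have -> : w * (1 + x * h) * (1 - x * h) = w - w * x ^+ 2 * h ^+ 2.
      rewrite -mulrA mulrDl mul1r mulrBr mulr1 addrA subrK mulrBr mulr1.
      by rewrite !expr2 !mulrA -(mulrA _ h x) hx !mulrA.
    by rewrite wx2 mul0r subr0.
  by rewrite w1 mulrBr mulr1 expr2 !mulrA -(mulrA c h x) hx !mulrA.
have [Hk kx ky] := Ck.
pose D := [set s | C s /\ (1 + x * s) * y = z * (1 + x * s)].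
have DH : D `<=` H by move=> h [[]].
have hc h : C h -> h * c = c * h.
  by move=> [Hh hx hy]; rewrite mulrBr mulrBl !mulrA hx hy -!mulrA hx hy.
have eqD h : D h -> c * h - c * x * h ^+ 2 = c * k - c * x * k ^+ 2.
  by move=> [Ch zh]; rewrite -(wE _ Ch zh) (wE _ Ck zk).
have xcx : x * (c * x) = 0.
  by rewrite -[c * x]opprK -xc mulrN mulrA -expr2 x2c oppr0.
have xc0 : x * (x * y) = x * y * x.
  apply: (omega_commute DH inf Hk) => h Dh; have [Ch _] := Dh.
  have -> : commutator x (x * y) = x * c by rewrite /c /commutator mulrBr !mulrA.
  have [_ hx _] := Ch.
  rewrite !mulrA hx kx -!mulrA !hc //.
  have := congr1 ( *%R x) (eqD _ Dh).
  by rewrite !mulrBr !(mulrA x (c * x)) xcx !mul0r !subr0.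
have cx0 : c * x = 0.
  apply/eqP; rewrite -oppr_eq0 -xc; apply/eqP.
  by rewrite /c /commutator mulrBr xc0 mulrA subrr.
apply: (omega_commute DH inf Hk) => h Dh; have [Ch _] := Dh.
by have := eqD _ Dh; rewrite cx0 !mul0r !subr0 -!hc.
Qed.

Lemma fc_idempotent_central e : FC e -> e * e = e -> commutes_with FC e.
Proof.
by apply: (idempotent_commutes fc_subring_subring); apply: fc_nilpotent_central.
Qed.

End Omega.
End FCSubring.

(** * Algebraic elements of the FC-subring commute *)

Section Algebraic.
Variables (F : fieldType) (R : algType F).
Implicit Types (a b u v x y z : R) (c : F).

Local Notation FC := (@fc_subring R).
Local Notation A := (@fc_algebraic F R).

Lemma fc_subalgebra : is_subalgebra FC.
Proof.
have [FC1 _ FCM] := fc_subring_subring R.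
apply: is_subalgebraP => // c x y fx fy; apply: subringD => //.
  exact: fc_subring_subring.
rewrite -mulr_algl; apply: FCM => //; apply: fc_central => u _.
by rewrite mulr_algl mulr_algr.
Qed.

(** If [p.[c] != 0] for a polynomial [p] annihilating [a], then [a - c] is
    a unit: [X - c] divides [p - p.[c]]. *)
Lemma algebraic_shift_unit a (p : {poly F}) c :
  horner_alg a p = 0 -> p.[c] != 0 -> unit_group (a - c%:A).
Proof.
move=> pa0 pc0.
have /factor_theorem[q qE] : root (p - p.[c]%:P) c.
  by rewrite rootE !hornerE subrr.
have e : horner_alg a q * (a - c%:A) = - p.[c]%:A.
  have := congr1 (horner_alg a) qE.
  by rewrite rmorphB rmorphM rmorphB /= horner_algX !horner_algC pa0 sub0r => <-.
have cq : horner_alg a q * (a - c%:A) = (a - c%:A) * horner_alg a q.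
  by have := mulrC q ('X - c%:P) => /(congr1 (horner_alg a));
    rewrite !rmorphM rmorphB /= horner_algX horner_algC.
exists (- (p.[c])^-1 *: horner_alg a q); rewrite -scalerAl -scalerAr -cq e.
by rewrite scalerN scaleNr opprK scalerA mulVf // scale1r.
Qed.

(** Two of the infinitely many units [a - c] conjugate [y] to the same [z];
    subtracting the two equations [(a - c) * y = z * (a - c)] gives [y = z]. *)
Lemma algebraic_commutes_infinite a y :
  infinite_set [set: F] -> is_algebraic a -> FC y -> a * y = y * a.
Proof.
move=> Finf [p p0 pa0] fy.
pose D := [set c : F | p.[c] != 0].
have Dinf : infinite_set D.
  have rootsfin : finite_set [set c : F | root p c].
    apply: contrapT => /(@infinite_set_fset _ _ (size p))[B Bp].
    rewrite leqNgt => /negP; apply; apply: max_poly_roots => //.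
      by apply/allP => c /Bp.
    exact: fset_uniq.
  by apply: sub_infinite_set (infinite_setD Finf rootsfin) => c [_ /negP].
have [z [c [Dc [inf zc]]]] := fc_infinite_same_conjugate fy Dinf
  (fun c => @algebraic_shift_unit a p c pa0).
have [d [Dd zd] neq_dc] := infinite_set_neq c inf.
have yz : y = z.
  have : (d - c) *: y = (d - c) *: z.
    have sub3 (q r s : R) : q - r - (q - s) = s - r.
      by rewrite opprB addrC addrA subrK.
    move: zc zd; rewrite !mulrBl !mulrBr !mulr_algl !mulr_algr => zc zd.
    by have := congr2 (fun q r => q - r) zc zd; rewrite /= !sub3 -!scalerBl.
  move/(congr1 ( *:%R (d - c)^-1)); rewrite !scalerA mulVf ?scale1r //.
  by rewrite subr_eq0; apply/eqP.
move: zc; rewrite -yz mulrBl mulrBr mulr_algl mulr_algr.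
exact: addIr.
Qed.

Lemma pchar_of_finite : finite_set [set: F] -> exists p : nat, p \in [pchar R].
Proof.
move=> Ffin; have [i [d]] : exists i d, i%:R = (i + d.+1)%:R :> F.
  by apply: (finite_range_repeat (f := fun n => n%:R : F)); apply: sub_finite_set Ffin.
rewrite natrD -[LHS]addr0 => /addrI/esym/eqP d0.
have [p pF] := natf0_pchar (ltn0Sn d) d0.
exists p; rewrite inE (pcharf_prime pF) /=.
by rewrite -scaler_nat (pcharf0 pF) scale0r.
Qed.

Section Omega.
Hypothesis omegaR : exists H : set R, omega_subgroup H.

Lemma fc_nilp_central x : FC x -> nilpotent x -> commutes_with FC x.
Proof. by case: omegaR => H HO; apply: (fc_nilpotent_central HO). Qed.

(** The conjugates of [u] and [v] generate a finite monoid, whose span over a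
    finite field is a finite ring. *)
Lemma fc_torsion_commute u v m n : finite_set [set: F] -> FC u -> FC v ->
  u ^+ m.+1 = 1 -> v ^+ n.+1 = 1 -> u * v = v * u.
Proof.
move=> Ffin fu fv um vn; have [p pR] := pchar_of_finite Ffin.
pose X0 := conjugates u `|` conjugates v.
have X0fin : finite_set X0 by rewrite finite_setU; split; apply/fcP.
have [X XE] := (finite_seqP X0).1 X0fin.
have inX x : (x \in X) <-> X0 x by rewrite XE.
have conj1 a b k : conjugates a b -> a ^+ k = 1 -> b ^+ k = 1.
  move=> [g Ug e] ak; apply: (unit_mulIr Ug); rewrite mul1r.
  have -> : b ^+ k * g = g * a ^+ k.
    elim: {ak} k => [|k IH]; first by rewrite mulr1 mul1r.
    by rewrite exprSr -mulrA -e mulrA IH -mulrA -exprSr.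
  by rewrite ak mulr1.
have torsX x : X0 x -> exists k, x ^+ k.+1 = 1.
  by case=> /conj1 h; [exists m|exists n]; apply: h.
have unitX x : X0 x -> unit_group x.
  move=> /torsX[k xk]; exists (x ^+ k).
  by rewrite -exprS -exprSr xk.
have fcX x : X0 x -> FC x by case; apply: fc_conjugate.
have conjX : {in X &, forall x y, exists2 z, z \in X & y * x = x * z}.
  move=> x y /inX Xx /inX Xy; have [x' [x'x xx']] := unitX _ Xx.
  have yz : conjugates y (x' * y * x).
    by exists x'; [exists x | rewrite -mulrA xx' mulr1].
  exists (x' * y * x); last by rewrite !mulrA xx' mul1r.
  by apply/inX; case: Xy => Xy; [left|right]; apply: conjugates_trans yz.
have powX : {in X, forall x, finite_set (range (fun k => x ^+ k))}.
  move=> x /inX/torsX[k xk].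
  apply: sub_finite_set (finite_image (fun i => x ^+ i) (finite_II k.+1)).
  move=> _ [i _ <-]; exists (i %% k.+1)%N; first by rewrite /= ltn_pmod.
  by rewrite {2}(divn_eq i k.+1) exprD mulnC exprM xk expr1n mul1r.
have [M ME] := (finite_seqP _).1 (finite_words conjX powX).
have inM x : (x \in M) <-> words X x by rewrite ME.
have sA : is_subalgebra (lspan M).
  apply: is_subalgebraP; last 2 first.
  - exact: lspan_linear.
  - move=> x y; apply: lspanM => a b /inM wa /inM wb.
    by apply: lspan_mem; apply/inM; apply: wordsM.
  - by apply: lspan_mem; apply/inM; apply: words1.
have sFC : lspan M `<=` FC.
  have [f1 fL _] := is_subalgebra_elim fc_subalgebra.
  apply: lspan_sub => //; first exact: subring0 (fc_subring_subring R).
  move=> x /inM; apply: words_sub; first exact: fc_subring_subring.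
  by move=> y /inX; apply: fcX.
have lspanX x : X0 x -> lspan M x.
  by move=> /inX xX; apply: lspan_mem; apply/inM; apply: words_letter.
apply: (finite_nilpotent_central_commutative (subalgebra_subring sA) _ _ pR).
- exact: lspan_finite.
- by move=> x /sFC fx nx y /sFC fy; apply: fc_nilp_central.
- by apply: lspanX; left; apply: conjugates_refl.
- by apply: lspanX; right; apply: conjugates_refl.
Qed.

(** Over a finite field an algebraic element of the FC-subring is a torsion unit
    up to a central summand.  With [e] an idempotent power of [a], the product
    [a * e] is invertible in the corner ring of [e] while [a * (1 - e)] is
    nilpotent, and both [e] and the nilpotent part are central. *)
Lemma fc_torsion_decomposition a : finite_set [set: F] -> A a ->
  exists u m, [/\ FC u, u ^+ m.+1 = 1 & commutes_with FC (a - u)].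
Proof.
move=> Ffin [fa algA]; have hF := fc_subring_subring R; have [FC1 FCB FCM] := hF.
have [d powa] := lspan_powers algA.
have [|m em] := @idempotent_power _ a.
  by apply: sub_finite_set (lspan_finite _ Ffin) => _ [n _ <-]; apply: powa.
set e := a ^+ m.+1 in em.
have fe : FC e by apply: subringX.
have [H HO] := omegaR.
have eC : commutes_with FC e by apply: (fc_idempotent_central HO).
have ae : a * e = e * a by rewrite eC.
have ff : (1 - e) * (1 - e) = 1 - e.
  by rewrite mulrBr mulr1 mulrBl mul1r em subrr subr0.
have ef : e * (1 - e) = 0 by rewrite mulrBr mulr1 em subrr.
have fe0 : (1 - e) * e = 0 by rewrite mulrBl mul1r em subrr.
have aN : nilpotent (a * (1 - e)).
  exists m.+1; rewrite exprMn_comm ?(idempotent_expr _ ff) //.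
  by rewrite /GRing.comm mulrBl mulrBr mul1r mulr1 ae.
have aNC := fc_nilp_central (FCM _ _ fa (FCB _ _ FC1 fe)) aN.
exists (a * e + (1 - e)), m; split.
- by apply: subringD => //; [apply: FCM|apply: FCB].
- by rewrite expr_idempotentD // em addrC subrK.
- have -> : a - (a * e + (1 - e)) = a * (1 - e) - (1 - e).
    by rewrite opprD addrA mulrBr mulr1.
  move=> y fy; rewrite mulrBl [RHS]mulrBr aNC //; congr (_ - _).
  by rewrite mulrBl mulrBr mul1r mulr1 eC.
Qed.

(** A central summand does not affect commutation, so over a finite field the
    question reduces to the torsion units of the decomposition. *)
Theorem fc_algebraic_commute a b : A a -> A b -> a * b = b * a.
Proof.
move=> Aa Ab; have [Ffin|Finf] := pselect (finite_set [set: F]); last first.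
  by apply: algebraic_commutes_infinite => //; [case: Aa|case: Ab].
have [u [m [fu um auC]]] := fc_torsion_decomposition Ffin Aa.
have [v [n [fv vn bvC]]] := fc_torsion_decomposition Ffin Ab.
have uv := fc_torsion_commute Ffin fu fv um vn.
have [_ FCB _] := fc_subring_subring R.
have ub : u * b = b * u.
  have := bvC u fu; rewrite mulrBl mulrBr uv => /addIr ->//.
have := auC b (proj1 Ab); rewrite mulrBl mulrBr ub => /addIr //.
Qed.

End Omega.
End Algebraic.

(** * Ideals generated by central nilpotents, and maximal left ideals *)

Section NilIdeal.
Variable R : nzRingType.
Implicit Types (S V : set R) (s : seq R) (x y z : R).

Lemma zmod_closedP S :
  GRing.zmod_closed (mem S) <-> S 0 /\ forall x y, S x -> S y -> S (x - y).
Proof.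
split=> [[/set_mem S0 SB]|[S0 SB]].
  by split=> // x y Sx Sy; apply: set_mem; apply: SB; apply/mem_set.
split; first exact/mem_set.
by move=> x y /set_mem Sx /set_mem Sy; apply/mem_set/SB.
Qed.

Section Central.
Variable S : set R.
Hypothesis hS : subring S.

Let SB x y : S x -> S y -> S (x - y). Proof. by case: hS => _ + _; apply. Qed.
Let SM x y : S x -> S y -> S (x * y). Proof. by case: hS => _ _; apply. Qed.

Let SD x y : S x -> S y -> S (x + y). Proof. exact: subringD. Qed.

(** For central entries of [l] this is the ideal of [S] that they generate; its
    recursive form lets nilpotence be proved one generator at a time. *)
Fixpoint ideal_span (l : seq R) : set R :=
  if l is x :: l' then [set v + x * r | v in ideal_span l' & r in S] else [set 0].

Lemma ideal_span_sub l : {in l, forall x, S x} -> ideal_span l `<=` S.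
Proof.
elim: l => [|x l IH] lS; first by move=> _ ->; apply: subring0.
move=> _ [v lv [r Sr <-]]; apply: (SD) => //.
  by apply: IH lv => y yl; apply: lS; rewrite inE yl orbT.
by apply: SM => //; apply: lS; rewrite mem_head.
Qed.

Lemma ideal_span0 l : ideal_span l 0.
Proof.
elim: l => //= x l IH; exists 0 => //; exists 0; first exact: subring0.
by rewrite mulr0 addr0.
Qed.

Lemma ideal_span_mem l x : {in l, forall x, S x} -> x \in l -> ideal_span l x.
Proof.
elim: l => //= y l IH lS; rewrite inE => /orP[/eqP->|xl].
  exists 0; first exact: ideal_span0.
  by exists 1; [case: hS | rewrite mulr1 add0r].
exists x; first by apply: IH => // z zl; apply: lS; rewrite inE zl orbT.
by exists 0; [apply: subring0 | rewrite mulr0 addr0].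
Qed.

Lemma ideal_span_subring l :
    {in l, forall x, S x /\ commutes_with S x} ->
  is_nonunital_subring (ideal_span l).
Proof.
elim: l => [|x l IH] lC.
  split; first by apply/zmod_closedP; split=> // _ _ -> ->; rewrite subrr.
  by move=> a b /set_mem -> /set_mem ->; apply/mem_set; rewrite mulr0.
have [Sx xC] := lC x (mem_head _ _).
have lC' : {in l, forall y, S y /\ commutes_with S y}.
  by move=> y yl; apply: lC; rewrite inE yl orbT.
have sub := @ideal_span_sub l (fun y yl => proj1 (lC' y yl)).
have [/zmod_closedP[_ IB] IM] := IH lC'.
split.
  apply/zmod_closedP; split; first exact: ideal_span0.
  move=> _ _ [v lv [r Sr <-]] [w lw [q Sq <-]].
  exists (v - w); first exact: IB.
  exists (r - q); first exact: SB.
  by rewrite mulrBr opprD addrACA.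
move=> _ _ /set_mem[v lv [r Sr <-]] /set_mem[w lw [q Sq <-]]; apply/mem_set.
have [Sv Sw] := (sub _ lv, sub _ lw).
exists (v * w); first by apply: set_mem; apply: IM; apply/mem_set.
exists (v * q + r * w + r * (x * q)).
  by apply: (SD); [apply: (SD)|]; apply: (SM) => //; apply: SM.
rewrite mulrDl !mulrDr -!addrA; congr (_ + _).
by rewrite !mulrA -(xC v) // -!mulrA.
Qed.

(** Adjoining one central nilpotent generator [x] with [x ^+ m = 0]: a product
    of [n] factors [v + x * r] lies in [x * S] when products of [n] elements
    [v] vanish, so a product of [n * m] factors lies in [x ^+ m * S = 0]. *)
Lemma ideal_span_nilpotent l :
    {in l, forall x, [/\ S x, commutes_with S x & nilpotent x]} ->
  exists n, forall s, size s = n -> {in s, forall y, ideal_span l y} ->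
    \prod_(y <- s) y = 0.
Proof.
elim: l => [|x l IH] lC.
  exists 1%N => -[|y []] //= _ h; rewrite big_seq1.
  exact: (h y (mem_head _ _)).
have [Sx xC [m xm0]] := lC x (mem_head _ _).
have lC' : {in l, forall y, [/\ S y, commutes_with S y & nilpotent y]}.
  by move=> y yl; apply: lC; rewrite inE yl orbT.
have sub : ideal_span l `<=` S by apply: ideal_span_sub => y /lC'[].
have [n n0] := IH lC'.
have expand s : {in s, forall y, ideal_span (x :: l) y} ->
    exists s' r, [/\ size s' = size s, {in s', forall y, ideal_span l y}, S r &
      \prod_(y <- s) y = \prod_(y <- s') y + x * r].
  elim: s => [|y s IHs] sl.
    exists [::], 0; split=> //; first exact: subring0.
    by rewrite mulr0 addr0.
  have [|s' [r [ss' sl' Sr e]]] := IHs.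
    by move=> z zs; apply: sl; rewrite inE zs orbT.
  have [v lv [q Sq e']] := sl y (mem_head _ _).
  have Sv := sub _ lv.
  exists (v :: s'), (v * r + q * \prod_(y <- s) y); split.
  - by rewrite /= ss'.
  - by move=> z; rewrite inE => /orP[/eqP->|/sl'].
  - apply: (SD) => //; apply: (SM) => //; rewrite e.
    apply: (SD) => //; last exact: SM.
    elim: s' {ss' e} sl' => [|z s' IHs'] sl'; first by rewrite big_nil; case: hS.
    rewrite big_cons; apply: SM; first by apply/sub/sl'; rewrite mem_head.
    by apply: IHs' => t ts'; apply: sl'; rewrite inE ts' orbT.
  - rewrite !big_cons -e' mulrDl {1}e !mulrDr -addrA; congr (_ + (_ + _)).
      by rewrite !mulrA -(xC v).
    by rewrite -mulrA.
have block s : size s = n -> {in s, forall y, ideal_span (x :: l) y} ->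
    exists2 r, S r & \prod_(y <- s) y = x * r.
  move=> sn /expand[s' [r [ss' sl' Sr ->]]]; exists r => //.
  by rewrite n0 ?add0r // ss'.
exists (n * m)%N => s ss sl.
suff [r _ ->] : exists2 r, S r & \prod_(y <- s) y = x ^+ m * r.
  by rewrite xm0 mul0r.
elim: {xm0} m s ss sl => [|m IHm] s ss sl.
  rewrite muln0 in ss; rewrite (size0nil ss) big_nil.
  by exists 1; [case: hS | rewrite mulr1].
have [||r Sr er] := block (take n s).
- by rewrite size_takel // ss mulnS leq_addr.
- by move=> y /mem_take/sl.
have [||q Sq eq] := IHm (drop n s).
- by rewrite size_drop ss mulnS addKn.
- by move=> y /mem_drop/sl.
exists (r * q); first exact: SM.
rewrite -[s in LHS](cat_take_drop n) big_cat /= er eq.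
by rewrite exprS -!mulrA; congr (x * _); rewrite !mulrA; congr (_ * _);
  apply: commrX; rewrite /GRing.comm xC.
Qed.
End Central.
End NilIdeal.

Section MaximalIdeal.
Variable R : nzRingType.
Implicit Types (S I L M B : set R) (x y : R).

Lemma left_ideal_full S L : is_left_ideal S L -> L 1 -> L = S.
Proof.
move=> [LS _ LM] L1; apply/seteqP; split=> // x Sx.
by rewrite -(mulr1 x); apply: LM.
Qed.

(** Zorn's lemma is applied to the sets whose union with [L] is a proper left
    ideal, so that the empty chain needs no separate bound. *)
Lemma maximal_left_ideal_above S L : subring S -> is_left_ideal S L -> ~ L 1 ->
  exists2 I, is_maximal_left_ideal S I & L `<=` I.
Proof.
move=> hS LI L1; pose P B := is_left_ideal S (L `|` B) /\ ~ (L `|` B) 1.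
have [C CP Ctot|A [[AI A1] Amax]] := @Zorn_bigcup R P; last first.
  exists (L `|` A); last exact: subsetUl.
  split=> // [e|M MI LAM]; first by apply: A1; rewrite e; case: hS.
  have [M1|M1] := pselect (M 1); first by right; apply: left_ideal_full.
  have LM : L `|` M = M by rewrite setUidr //; apply: subset_trans LAM; apply: subsetUl.
  have AM : A `<=` M by apply: subset_trans LAM; apply: subsetUr.
  have [MA|MA] := pselect (M `<=` A).
    by left; apply/seteqP; split=> // x /MA; right.
  by case: (Amax M); [split|rewrite /P LM].
pose U := L `|` \bigcup_(X in C) X.
have two x y : U x -> U y -> exists M, [/\ is_left_ideal S M, M `<=` U, M x & M y].
  have BU B : C B -> L `|` B `<=` U.
    by move=> CB z [Lz|Bz]; [left|right; exists B].
  move=> [Lx|[B CB Bx]] [Ly|[B' CB' By]].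
  - by exists L; split=> // z; left.
  - exists (L `|` B'); split; [by case: (CP _ CB')|exact: BU|by left|by right].
  - exists (L `|` B); split; [by case: (CP _ CB)|exact: BU|by right|by left].
  - have [BB|BB] := Ctot _ _ CB CB'.
      exists (L `|` B'); split; [by case: (CP _ CB')|exact: BU|right; exact: BB|by right].
    exists (L `|` B); split; [by case: (CP _ CB)|exact: BU|by right|right; exact: BB].
have [LS /zmod_closedP[L0 _] _] := LI.
split; last first.
  by case=> // -[B CB B1]; have [_] := CP _ CB; apply; right.
split.
- by move=> x [/LS//|[B CB Bx]]; have [[BS _ _] _] := CP _ CB; apply: BS; right.
- apply/zmod_closedP; split; first by left.
  move=> x y Ux Uy; have [M [[_ /zmod_closedP[_ MB] _] MU Mx My]] := two x y Ux Uy.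
  exact/MU/MB.
- move=> x y Sx Uy; have [M [[_ _ MM] MU _ My]] := two y y Uy Uy.
  exact/MU/MM.
Qed.

End MaximalIdeal.

(** * The structure of the algebraic part *)

Section Structure.
Variables (F : fieldType) (R : algType F).
Hypothesis omegaR : exists H : set R, omega_subgroup H.
Implicit Types (a b x y : R) (l : seq R).

Local Notation FC := (@fc_subring R).
Local Notation A := (@fc_algebraic F R).
Local Notation J := (jacobson_radical A).

Let FCring : subring FC. Proof. exact: fc_subring_subring. Qed.
Let AC a b : A a -> A b -> a * b = b * a. Proof. exact: fc_algebraic_commute. Qed.

Lemma fc_algebraic_lspan l : {in l, forall x, A x} ->
  exists s, [/\ is_subalgebra (lspan s), lspan s `<=` A &
    lspan s = generated_subalgebra [set` l]].
Proof.
move=> lA; have [||s [sA ls smin]] := @commuting_algebraic_span F R l.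
- by move=> x /lA[].
- by move=> x y /lA Ax /lA; apply: AC.
exists s; have [s1 sL sM] := is_subalgebra_elim sA.
have sub S : is_subalgebra S -> {in l, forall x, S x} -> lspan s `<=` S.
  move=> SA lS; have [S1 SL _] := is_subalgebra_elim SA.
  apply: lspan_sub => //; last exact: smin.
  exact: subring0 (subalgebra_subring SA).
split=> //.
  move=> x sx; split; first by apply: sub sx; [exact: fc_subalgebra | move=> y /lA[]].
  by apply: (@lspan_algebraic _ _ s) => n; apply: (subringX (subalgebra_subring sA)).
apply/seteqP; split; last by apply: smallest_sub => // x; apply: ls.
by move=> x sx S [SA lS]; apply: sub sx.
Qed.

Lemma fc_algebraic_subalgebra : is_subalgebra A.
Proof.
have pair x y : A x -> A y -> exists s,
    [/\ is_subalgebra (lspan s), lspan s `<=` A, lspan s x & lspan s y].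
  move=> Ax Ay; have [z|s [sA sub e]] := @fc_algebraic_lspan [:: x; y].
    by rewrite !inE => /orP[]/eqP->.
  exists s; split=> //; rewrite e => S [_]; apply; by rewrite /= !inE eqxx ?orbT.
have A0 : A 0.
  split; first exact: subring0.
  by apply: is_algebraic_nilpotent; apply: nilpotent0.
apply: is_subalgebraP => [|c x y Ax Ay|x y Ax Ay].
- have [s [/is_subalgebra_elim[s1 _ _] sub _ _]] := pair 0 0 A0 A0; exact: sub.
- have [s [/is_subalgebra_elim[_ sL _] sub sx sy]] := pair x y Ax Ay.
  by apply/sub/sL.
- have [s [/is_subalgebra_elim[_ _ sM] sub sx sy]] := pair x y Ax Ay.
  by apply/sub/sM.
Qed.

Lemma fc_algebraic_locally_finite : is_locally_finite_algebra A.
Proof.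
split=> [|X Xfin XA]; first exact: fc_algebraic_subalgebra.
have [l lX] := (finite_seqP X).1 Xfin; rewrite lX.
have [|s [_ _ <-]] := @fc_algebraic_lspan l.
  by move=> x xl; apply: XA; rewrite lX.
by exists (size s), (fun i => s`_i); rewrite lspanE.
Qed.

Let Aring : subring A.
Proof. by apply: subalgebra_subring; apply: fc_algebraic_subalgebra. Qed.

Let nilC x : FC x -> nilpotent x -> commutes_with FC x.
Proof. exact: fc_nilp_central. Qed.

(** The nilpotent elements lie in every maximal left ideal [I], for otherwise
    [1 = i + a * x] with [i] in [I]; then [I] contains every
    [1 - (a * x) ^+ k], hence [1].
    Conversely write [q * 'X^k] with [q.[0] != 0] for a polynomial annihilating
    [x].  If [x] is not nilpotent, the left ideal [A * q(x)] is proper because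
    [q(x) * x ^+ k = 0]; a maximal left ideal above it that also contains [x]
    contains the non-zero scalar [q.[0]]. *)
Lemma jacobson_fc_algebraic : J = [set x | FC x /\ nilpotent x].
Proof.
have [A1 AB AM] := Aring.
apply/seteqP; split=> [x [Ax Jx]|x [fx nx]].
  have [fx [p p0 px0]] := Ax; split=> //; apply: contrapT => nN.
  have [k [q]] := multiplicity_XsubC p 0; rewrite p0 /= => q0 pE.
  have powA (g : {poly F}) : A (horner_alg x g).
    have [_ AL _] := is_subalgebra_elim fc_algebraic_subalgebra.
    rewrite horner_alg_sum; elim/big_rec: _ => [|i y _ Ay]; first exact: subring0.
    by apply: AL => //; apply: subringX.
  have qxk : horner_alg x q * x ^+ k = 0.
    by rewrite -px0 pE subr0 rmorphM rmorphXn /= horner_algX.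
  pose L := [set a * horner_alg x q | a in A].
  have LI : is_left_ideal A L.
    split.
    - by move=> _ [a Aa <-]; apply: AM.
    - apply/zmod_closedP; split.
        by exists 0; [apply: subring0 | rewrite mul0r].
      by move=> _ _ [a Aa <-] [b Ab <-]; exists (a - b); [apply: AB | rewrite mulrBl].
    - by move=> a _ Aa [b Ab <-]; exists (a * b); [apply: AM | rewrite mulrA].
  have L1 : ~ L 1.
    move=> [a Aa e]; apply: nN; exists k.
    by rewrite -(mul1r (x ^+ k)) -e -mulrA qxk mulr0.
  have [I Imax LI'] := maximal_left_ideal_above Aring LI L1.
  have [[IA /zmod_closedP[_ IB] IM] IneqA _] := Imax.
  have Ix : I x by apply: Jx.
  have /factor_theorem[r rE] : root (q - q.[0]%:P) 0.
    by rewrite rootE !hornerE subrr.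
  have cI : I (q.[0])%:A.
    have -> : (q.[0])%:A = horner_alg x q - horner_alg x r * x.
      have := congr1 (horner_alg x) rE.
      rewrite subr0 rmorphM rmorphB /= horner_algX horner_algC => <-.
      by rewrite opprB addrC subrK.
    apply: IB; last exact: IM.
    by apply: LI'; exists 1; rewrite ?mul1r.
  apply: IneqA; apply: left_ideal_full; first by case: Imax.
  have -> : (1 : R) = (q.[0])^-1%:A * (q.[0])%:A.
    by rewrite mulr_algl scalerA mulVf ?scale1r.
  by apply: (IM) => //; rewrite -(horner_algC x); exact: powA.
have Ax : A x by split=> //; apply: is_algebraic_nilpotent.
split=> // I Imax; have [[IA /zmod_closedP[I0 IB] IM] IneqA ImaxP] := Imax.
apply: contrapT => nIx.
pose L := [set i + a * x | i in I & a in A].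
have LI : is_left_ideal A L.
  split.
  - by move=> _ [i Ii [a Aa <-]]; apply: subringD => //; [apply: IA|apply: AM].
  - apply/zmod_closedP; split.
      by exists 0 => //; exists 0; [apply: subring0 | rewrite mul0r addr0].
    move=> _ _ [i Ii [a Aa <-]] [j Ij [b Ab <-]].
    exists (i - j); first exact: IB.
    by exists (a - b); [apply: AB | rewrite mulrBl opprD addrACA].
  - move=> b _ Ab [i Ii [a Aa <-]]; exists (b * i); first exact: IM.
    by exists (b * a); [apply: AM | rewrite mulrDr mulrA].
have IL : I `<=` L.
  by move=> i Ii; exists i => //; exists 0; [apply: subring0 | rewrite mul0r addr0].
case: (ImaxP _ LI IL) => eL.
  by apply: nIx; rewrite -eL; exists 0 => //; exists 1; rewrite ?mul1r ?add0r.
move: A1; rewrite -{1}eL => -[i Ii [a Aa e]].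
have [n axn] : nilpotent (a * x).
  have fa : FC a by case: Aa.
  by rewrite -(nilC fx nx) //; apply: nilpotentM => //; apply: nilC.
have I1B k : I (1 - (a * x) ^+ k).
  elim: k => [|k IH]; first by rewrite subrr.
  have -> : 1 - (a * x) ^+ k.+1 = i - - (a * x * (1 - (a * x) ^+ k)).
    by rewrite opprK mulrBr mulr1 -exprS addrA e.
  apply: (IB) => //; rewrite -sub0r; apply: (IB) => //.
  by apply: IM => //; apply: AM.
apply: IneqA; apply: left_ideal_full; first by case: Imax.
by have := I1B n; rewrite axn subr0.
Qed.

Lemma jacobson_fc_ideal : is_ideal FC J.
Proof.
have [FC1 FCB FCM] := FCring.
have JM x y : FC x -> FC y -> nilpotent y -> nilpotent (y * x).
  by move=> fx fy ny; apply: nilpotentM => //; apply: nilC.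
rewrite jacobson_fc_algebraic; split=> [|x y [fx nx] fy]; last first.
  by split; [apply: FCM | apply: JM].
split; first by move=> x [].
  apply/zmod_closedP; split=> [|x y [fx nx] [fy ny]].
    by split; [apply: subring0 | apply: nilpotent0].
  split; first exact: FCB.
  apply: nilpotentD => //; last exact: nilpotentN.
  by apply: nilC => //; apply: subringN.
move=> x y fx [fy ny]; split; first exact: FCM.
by rewrite -(nilC fy ny) //; apply: JM.
Qed.

Lemma jacobson_fc_central : J `<=` center_of FC.
Proof. by rewrite jacobson_fc_algebraic => x [fx nx]; split=> //; apply: nilC. Qed.

Lemma jacobson_fc_locally_nilpotent : is_locally_nilpotent J.
Proof.
rewrite jacobson_fc_algebraic => X Xfin XJ.
have [l lX] := (finite_seqP X).1 Xfin.
have lC : {in l, forall x, [/\ FC x, commutes_with FC x & nilpotent x]}.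
  by move=> x xl; have [fx nx] : FC x /\ nilpotent x by [apply: XJ; rewrite lX];
    split=> //; apply: nilC.
have [n n0] := ideal_span_nilpotent FCring lC.
exists n.
  case: n n0 => // n0; have nil_in : {in [::] : seq R, forall y, ideal_span FC l y} by [].
  by have /eqP := n0 [::] erefl nil_in; rewrite big_nil oner_eq0.
move=> s sX; have -> : \prod_(i < n) s i = \prod_(y <- mktuple s) y.
  by rewrite big_tuple; apply: eq_bigr => i _; rewrite tnth_mktuple.
apply: n0; first by rewrite size_tuple.
move=> _ /tnthP[i ->]; rewrite tnth_mktuple.
apply: (smallest_sub _ _ (sX i)).
  by apply: ideal_span_subring => // x /lC[].
by move=> x; rewrite lX => xl; apply: ideal_span_mem => // y /lC[].
Qed.

Lemma fc_algebraic_commutative_quotient : is_commutative_quotient A J.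
Proof.
have sub Y Z : quotient_by A J Y -> quotient_by A J Z ->
    coset_mul J Y Z `<=` coset_mul J Z Y.
  have inA W x : quotient_by A J W -> W x -> A x.
    by move=> [a Aa <-] [j [Aj _] <-]; apply: subringD.
  move=> YA ZA _ [[y z] [/= Yy Zz] [j Jj <-]].
  by exists (z, y) => //; exists j => //=; rewrite (AC (inA _ _ YA Yy) (inA _ _ ZA Zz)).
by move=> Y Z YA ZA; apply/seteqP; split; apply: sub.
Qed.

End Structure.

Theorem theorem1 (F : fieldType) (R : algType F)
    (homega : exists H : set R, omega_subgroup H) :
  let A : set R := fc_algebraic in
  let J : set R := jacobson_radical A in
  [/\ is_locally_finite_algebra A,
      [/\ is_ideal fc_subring J,
          J `<=` center_of fc_subring
        & is_locally_nilpotent J]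
    & is_commutative_quotient A J].
Proof.
split; first exact: fc_algebraic_locally_finite.
  split; first exact: jacobson_fc_ideal.
    exact: jacobson_fc_central.
  exact: jacobson_fc_locally_nilpotent.
exact: fc_algebraic_commutative_quotient.
Qed.
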